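(* Let $\gamma>c_0$ be given. Then there is a monotone random transition front of $$\dot{u}_i(t)=u_{i+1}(t)-2u_i(t)+u_{i-1}(t)+a(\theta_t\omega)u_i(t)(1-u_i(t)),\qquad i\in\mathbb{Z},\qquad (\ast)$$ with least mean speed $\overline{c}_{\inf}=\gamma$. More precisely, let $0<\mu<\mu^*$ be such that $\frac{e^{\mu}+e^{-\mu}-2+\underline{a}}{\mu}=\gamma$. Then $(\ast)$ has a monotone random transition front $u(t;\omega)=\{u_i(t;\omega)\}_{i\in\mathbb{Z}}$ with $$u_i(t;\omega)=\Phi\Big(i-\int_0^t c(s;\omega,\mu)\,ds,\ \theta_t\omega\Big),\qquad c(t;\omega,\mu)=\frac{e^{\mu}+e^{-\mu}-2+a(\theta_t\omega)}{\mu},$$ and hence $\overline{c}_{\inf}=\frac{e^{\mu}+e^{-\mu}-2+\underline{a}}{\mu}=\gamma$. Moreover, for any $\omega\in\Omega_0$, $$\lim_{x\to-\infty}\Phi(x,\theta_t\omega)=1\quad\text{and}\quad \lim_{x\to\infty}\frac{\Phi(x,\theta_t\omega)}{e^{-\mu x}}=1\quad\text{uniformly in } t\in\mathbb{R}.$$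
   Context: Setting: $(\Omega,\mathcal{F},\mathbb{P})$ is a probability space, $\{\theta_t\}_{t\in\mathbb{R}}$ is an ergodic metric dynamical system on it (a jointly measurable, measure-preserving, ergodic flow on $\Omega$), $a:\Omega\to(0,\infty)$ is measurable, and $t\mapsto a(\theta_t\omega)$ is locally H\''older continuous on $\mathbb{R}$ for every $\omega\in\Omega$. Define $$\underline{a}(\omega)=\liminf_{t-s\to\infty}\frac{1}{t-s}\int_s^t a(\theta_\tau\omega)\,d\tau:=\lim_{r\to\infty}\inf_{t-s\ge r}\frac{1}{t-s}\int_s^t a(\theta_\tau\omega)\,d\tau,$$ $$\overline{a}(\omega)=\limsup_{t-s\to\infty}\frac{1}{t-s}\int_s^t a(\theta_\tau\omega)\,d\tau:=\lim_{r\to\infty}\sup_{t-s\ge r}\frac{1}{t-s}\int_s^t a(\theta_\tau\omega)\,d\tau.$$ Standing assumption: $0<\underline{a}(\omega)\le\overline{a}(\omega)<\infty$ for a.e. $\omega\in\Omega$. By ergodicity there are constants $\underline{a},\overline{a}>0$ and a measurable set $\Omega_0\subset\Omega$ with $\mathbb{P}(\Omega_0)=1$, $\theta_t\Omega_0=\Omega_0$ for all $t\in\mathbb{R}$, and $\underline{a}(\omega)=\underline{a}$, $\overline{a}(\omega)=\overline{a}$ for all $\omega\in\Omega_0$; these are fixed. Let $c_0:=\inf_{\mu>0}\frac{e^{\mu}+e^{-\mu}-2+\underline{a}}{\mu}$, and let $\mu^*>0$ be the unique positive number with $c_0=\frac{e^{\mu^*}+e^{-\mu^*}-2+\underline{a}}{\mu^*}$.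 (For every $\gamma>c_0$, the equation $\gamma=\frac{e^{\mu}+e^{-\mu}-2+\underline{a}}{\mu}$ has exactly two positive solutions $\mu$.) An entire solution is a solution $u(t;\omega)=\{u_i(t;\omega)\}_{i\in\mathbb{Z}}$ of $(\ast)$ defined for all $t\in\mathbb{R}$. An entire solution is called a random transition front (connecting $1$ and $0$) if for a.e. $\omega\in\Omega$, $u_i(t;\omega)=\Phi(i-\int_0^t c(s;\omega)\,ds,\theta_t\omega)$ for some $\Phi(x,\omega)$ ($x\in\mathbb{R}$) and $c(t;\omega)$, both measurable in $\omega$, such that for a.e. $\omega\in\Omega$: $0<\Phi(x,\omega)<1$, and $\lim_{x\to-\infty}\Phi(x,\theta_t\omega)=1$, $\lim_{x\to\infty}\Phi(x,\theta_t\omega)=0$ uniformly in $t\in\mathbb{R}$. It is monotone if $\Phi(x,\omega)$ is non-increasing in $x\in\mathbb{R}$ for a.e. $\omega\in\Omega$. If there is $\overline{c}_{\inf}\in\mathbb{R}$ such that $\liminf_{t-s\to\infty}\frac{1}{t-s}\int_s^t c(\tau;\omega)\,d\tau=\overline{c}_{\inf}$ for a.e. $\omega\in\Omega$, then $\overline{c}_{\inf}$ is called its least mean speed. *)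

(* Defs.v *)
From HB Require Import structures.
From mathcomp Require Import all_boot all_order all_algebra.
From mathcomp Require Import all_classical all_reals all_analysis.

Set Implicit Arguments.
Unset Strict Implicit.
Unset Printing Implicit Defensive.

Import Order.TTheory GRing.Theory Num.Theory.
Import numFieldNormedType.Exports.

Local Open Scope classical_set_scope.
Local Open Scope ring_scope.

Section Averages.
Context {R : realType}.
Implicit Types f : R -> R.

(* The oriented integral from [s] to [t], with either order of the bounds. *)
Definition oint f (s t : R) : R :=
  if s <= t then \int[lebesgue_measure]_(x in `[s, t]) f x
  else - \int[lebesgue_measure]_(x in `[t, s]) f x.

Definition unif_cvg (f : R -> R -> R) (F : set_system R) (l : R) : Prop :=
  {uniform, f @ F --> (cst l : R -> R)}.

Definition averages f (r : R) : set \bar R :=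
  [set m | exists s t : R, r <= t - s /\ m = ((t - s)^-1 * oint f s t)%:E].

Definition lower_mean f : \bar R := lim (ereal_inf (averages f r) @[r --> +oo]).

Definition upper_mean f : \bar R := lim (ereal_sup (averages f r) @[r --> +oo]).

(* The exponent and the constant may depend on the point. *)
Definition locally_holder f : Prop :=
  forall t0 : R, exists alpha C : R, 0 < alpha <= 1 /\
    \forall s & t \near t0, `|f s - f t| <= C * `|s - t| `^ alpha.

End Averages.

Section RandomLattice.
Context {R : realType} {d : measure_display} {Omega : measurableType d}.
Variable P : probability Omega R.
Implicit Types (theta : R -> Omega -> Omega) (a : Omega -> R).

Definition ergodic_mds theta : Prop :=
  [/\ measurable_fun setT
        (fun p : measurableTypeR R * Omega => theta p.1 p.2),
      (forall w, theta 0 w = w),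
      (forall s t w, theta (s + t) w = theta s (theta t w)),
      (forall t A, measurable A -> P (theta t @^-1` A) = P A) &
      (forall A, measurable A -> (forall t, theta t @^-1` A = A) ->
         P A = 0%E \/ P A = 1%E)].

(* Solutions of the lattice equation on all of [R], for every realization;
   [u i t w] is u_i(t; w). *)
Definition entire_solution theta a (u : int -> R -> Omega -> R) : Prop :=
  forall w i t,
    is_derive t (1 : R) (fun s => u i s w)
      (u (i + 1) t w - 2 * u i t w + u (i - 1) t w
       + a (theta t w) * u i t w * (1 - u i t w)).

Definition front_form theta (u : int -> R -> Omega -> R)
    (Phi : R -> Omega -> R) (c : R -> Omega -> R) (w : Omega) : Prop :=
  forall i t, u i t w = Phi (i%:~R - oint (c ^~ w) 0 t) (theta t w).

(* An entire solution [u] that is a random transition front connecting 1 and 0,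
   with profile [Phi] and speed [c].  Local integrability of [c ^~ w] makes the
   integrals of [c ^~ w] meaningful (the integral of the library is total). *)
Definition random_transition_front theta a (u : int -> R -> Omega -> R)
    (Phi : R -> Omega -> R) (c : R -> Omega -> R) : Prop :=
  [/\ entire_solution theta a u,
      (forall x, measurable_fun setT (Phi x)) /\
      (forall t, measurable_fun setT (c t)),
      {ae P, forall w, locally_integrable setT (c ^~ w)},
      {ae P, forall w, front_form theta u Phi c w} &
      {ae P, forall w,
         [/\ (forall x, 0 < Phi x w < 1),
             unif_cvg (fun x t => Phi x (theta t w)) -oo 1 &
             unif_cvg (fun x t => Phi x (theta t w)) +oo 0]}].

Definition monotone_profile (Phi : R -> Omega -> R) : Prop :=
  {ae P, forall w, nonincreasing_fun (Phi ^~ w)}.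

Definition least_mean_speed (c : R -> Omega -> R) (cinf : R) : Prop :=
  {ae P, forall w, lower_mean (c ^~ w) = cinf%:E}.

End RandomLattice.

Section Speeds.
Context {R : realType}.

Definition speed (alpha mu : R) : R :=
  (expR mu + expR (- mu) - 2 + alpha) / mu.

Definition minimal_speed (alpha : R) : R :=
  inf [set speed alpha mu | mu in [set mu | 0 < mu]].

End Speeds.

(* Main.v *)
Require Import Defs.
From mathcomp Require Import all_boot all_order all_algebra.
From mathcomp Require Import all_classical all_reals all_analysis.
From mathcomp Require Import measurable_realfun ring lra.
Set Implicit Arguments.
Unset Strict Implicit.
Unset Printing Implicit Defensive.
Import Order.TTheory GRing.Theory Num.Theory.
Import numFieldNormedType.Exports.
Local Open Scope classical_set_scope.
Local Open Scope ring_scope.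

(** Write Psi = 1 - Phi for the profile seen from the unstable state.  Along an
    orbit, with kappa(t) = 2 + a(theta_t w) and psi_x(t) = Psi(x - C(t), theta_t w),
    C being the integral of the speed c, the lattice equation reads
      psi_x' = psi_(x+1) + psi_(x-1) + a psi_x^2 - kappa psi_x,
    and its solutions that are bounded on the whole time line are the fixed
    points of the Duhamel operator
      (T psi)_x(t) = int_(s <= t) exp(- int_s^t kappa)
                       (psi_(x+1) + psi_(x-1) + a psi_x^2)(s) ds.
    This operator (step) is monotone on functions with values in [0, 1] because
    the gain term has nonnegative coefficients once the unknown is 1 - Phi.  It
    acts directly on functions of (x, w), for real x, so a fixed point is at once
    a profile, and its measurability in w comes for free from Tonelli.  No
    Cauchy problem has to be solved.

    The exponential exp (- mu (x - C(t))) solves the linearised equation exactly: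
    this is how c is chosen.  Hence barrier x = max 0 (1 - exp (- mu x)), which
    does not depend on w, satisfies barrier <= T barrier
    (barrier_le_step), the iterates of T from barrier increase, and by monotone
    convergence their limit is a fixed point (profile_fixed).  It is
    nondecreasing in x, and it is differentiable along orbits because Duhamel
    integrals are (is_derive_orbit_profile).

    What remains is to bound the limit from above, and this uses
    supersolutions of T with random coefficients.  Two of them are needed.
    - Ahead of the front, 1 - exp (- mu z) + D(t) exp (- mu1 z) with mu1 slightly
      larger than mu (leading_edge_bound).  It gives Phi ~ exp (- mu z), and in
      particular Psi <= q0 < 1 on some left half-line.
    - Behind the front, B(t) exp (lam z) with lam > 0 small, where the
      quadratic term is absorbed thanks to q0 < 1 (trailing_edge_bound).  It
      gives Phi -> 1.
    In both cases pointwise signs are not available since a(theta_t w) may stay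
    close to 0 for a while; only its averages are controlled.  The coefficients
    D and B absorb the fluctuations: up to a constant factor they solve
    D' + (k a - h) D = a, whose solution is bounded as soon as the average of k a - h
    over long windows is bounded below by a positive number (corrector).  At the
    leading edge this requires speed mu1 < speed mu, which holds for some mu1
    close to mu because mu lies to the left of the minimiser and exp is convex
    (slower_exponent); at the trailing edge it holds for every small lam
    (small_decay_exponent). *)

(** * Uniform limits and half-line integrals *)

Section HalfLine.
Context {R : realType}.
Notation mu := (@lebesgue_measure R).
Implicit Types (t : R).

Lemma unif_cvg_near (f : R -> R -> R) (F : set_system R) (l : R) : Filter F ->
  (forall e, 0 < e -> \forall x \near F, forall t, `|f x t - l| < e) ->
  unif_cvg f F l.
Proof.
move=> FF H P /uniform_nbhs [E [entE EP]].
move: entE => /= -[e e0 eE].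
rewrite /nbhs/=; near=> x; apply: EP => t _ /=.
apply: eE => /=; rewrite /ball_/= distrC.
by move: t; near: x; exact: H.
Unshelve. all: by end_near. Qed.

(** The pushforward of the Lebesgue measure by a translation agrees with it on
    half-open intervals, hence everywhere. *)
Lemma ge0_integral_translation (f : R -> \bar R) t :
  measurable_fun setT f -> (forall s, (0 <= f s)%E) ->
  (\int[mu]_(s in `]-oo, 0%R]) f (t + s)%R = \int[mu]_(s in `]-oo, t]) f s)%E.
Proof.
move=> mf f0; pose phi : measurableTypeR R -> measurableTypeR R := fun s => t + s.
have mt : measurable_fun setT phi by exact: measurable_funD.
have -> : (\int[mu]_(s in `]-oo, t]) f s =
  \int[pushforward mu phi]_(s in `]-oo, t]) f s)%E.
  apply: eq_measure_integral => A mA _ /=.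
  apply: (lebesgue_measure_unique (mu := pushforward mu phi)) => //.
  move=> _ [[a b] _ <-] /=.
  transitivity (mu `]a - t, b - t]%classic); last first.
    congr (mu _); apply/seteqP; split => x /=; rewrite /phi !in_itv/=;
      by rewrite ltrBlDl lerBrDl.
  rewrite [LHS]lebesgue_measure_itv [RHS]lebesgue_measure_itv/= !lte_fin ltrD2r.
  by case: ifPn => // _; rewrite -!EFinD; congr EFin; ring.
rewrite ge0_integral_pushforward//; last exact: measurable_funTS.
congr (integral _ _ _).
by apply/seteqP; split => x /=; rewrite /phi !in_itv/= gerDl.
Qed.

(** Monotone convergence along the segments [t - n, t]: the way every
    half-line integral below is bounded, since the fundamental theorem of
    calculus is applied on segments only. *)
Lemma integral_halfline_le (f : R -> R) t (M : \bar R) :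
  measurable_fun setT f -> (forall s, 0 <= f s) ->
  (forall r, r < t -> (\int[mu]_(s in `[r, t]) (f s)%:E <= M)%E) ->
  (\int[mu]_(s in `]-oo, t]) (f s)%:E <= M)%E.
Proof.
move=> mf f0 fM.
pose F (n : nat) : set (measurableTypeR R) := `[t - n.+1%:R, t]%classic.
have FE : `]-oo, t]%classic = \bigcup_n F n.
  apply/seteqP; split => x /=; rewrite in_itv/=; last first.
    by move=> [n _]; rewrite /F/= in_itv/= => /andP[].
  move=> xt; exists (Num.bound (t - x)) => //.
  rewrite /F /= in_itv/= xt andbT lerBlDr -lerBlDl.
  have tx0 : 0 <= t - x by rewrite subr_ge0.
  rewrite (le_trans (ltW (archi_boundP tx0)))//.
  by rewrite ler_nat.
have := @ge0_nondecreasing_set_cvg_integral _ (measurableTypeR R) R F (EFin \o f) mu.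
rewrite -FE => H; apply: (cvge_to_le (H _ _ _ _)).
- apply/nondecreasing_seqP => n; rewrite subsetEset.
  move=> x; rewrite /F /= !in_itv/= => /andP[tx ->]; rewrite andbT.
  by rewrite (le_trans _ tx)// lerD2l lerN2 ler_nat.
- by move=> n; exact: measurable_itv.
- by move=> n; apply/measurable_EFinP/measurable_funTS.
- by move=> n x _; rewrite lee_fin.
- by apply: nearW => n; apply: fM; rewrite ltrBlDr ltrDl.
Qed.

End HalfLine.

(** * Duhamel integrals and comparison *)

Section Duhamel.
Context {R : realType}.
Notation mu := (@lebesgue_measure R).

Lemma is_derive_continuous (f df : R -> R) :
  (forall s, is_derive s (1 : R) f (df s)) -> continuous f.
Proof.
move=> fdf s; apply/differentiable_continuous/derivable1_diffP.
by have [] := fdf s.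
Qed.

Lemma integral_derivative (F f : R -> R) r t : r < t ->
  (forall s, is_derive s (1 : R) F (f s)) -> continuous f ->
  (\int[mu]_(s in `[r, t]) (f s)%:E = (F t - F r)%:E)%E.
Proof.
move=> rt dF cf; rewrite EFinB; apply: continuous_FTC2 => //.
- exact: continuous_subspaceT.
- have cF := is_derive_continuous dF.
  split; [by move=> x _; have [] := dF x|..].
  + exact/cvg_at_right_filter/cF.
  + exact/cvg_at_left_filter/cF.
- by move=> x _; rewrite derive1E; have [_ ->] := dF x.
Qed.

Lemma measurable_EFin_restr (f : R -> R) (D : set (measurableTypeR R)) :
  measurable_fun setT f ->
  measurable_fun D ((fun x => (f x)%:E) : measurableTypeR R -> \bar R).
Proof. by move=> mf; apply/measurable_EFinP; exact: measurable_funTS. Qed.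

(** The function g may change sign: its positive part is still below f. *)
Lemma integral_le_ge0 (g f : R -> R) (D : set (measurableTypeR R)) :
  measurable D -> measurable_fun setT g -> measurable_fun setT f ->
  (forall s, 0 <= f s) -> (forall s, D s -> g s <= f s) ->
  (\int[mu]_(s in D) (g s)%:E <= \int[mu]_(s in D) (f s)%:E)%E.
Proof.
move=> mD mg mf f0 gf; rewrite integralE.
apply: (@le_trans _ _ (\int[mu]_(s in D) ((EFin \o g)^\+ s))%E).
  by rewrite geeDl// oppe_le0; apply: integral_ge0.
apply: ge0_le_integral => //.
- have mgD : measurable_fun D (EFin \o g).
    by apply/measurable_EFinP; exact: measurable_funTS.
  exact (measurable_funepos mgD).
- by apply/measurable_EFinP/measurable_funTS.
- by move=> s Ds; rewrite funeposE/= ge_max !lee_fin f0 gf.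
Qed.

(** The solution at time t of y' = F - kappa y that started from 0 at time
    -oo, where I is any primitive of kappa. Its values are extended reals, so
    that finiteness can be proved afterwards from a supersolution. *)
Definition duhamel (I F : R -> R) (t : R) : \bar R :=
  \int[mu]_(s in `]-oo, t]) (expR (I s - I t) * F s)%:E.

Context (kappa I : R -> R).
Hypothesis dI : forall s, is_derive s (1 : R) I (kappa s).
Hypothesis ckappa : continuous kappa.

Lemma is_derive_expR_comp (f : R -> R) df s :
  is_derive s (1 : R) f df -> is_derive s (1 : R) (fun x => expR (f x)) (df * expR (f s)).
Proof. by move=> dfs; rewrite mulrC; exact: (@is_derive1_comp _ expR f). Qed.

Lemma measurable_duhamel (F : R -> R) t : measurable_fun setT F ->
  measurable_fun setT (fun s => expR (I s - I t) * F s).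
Proof.
move=> mF; have mI := continuous_measurable_fun (is_derive_continuous dI).
have mB : measurable_fun setT (fun s => I s - I t).
  by apply: measurable_funB => //; exact: measurable_cst.
apply: measurable_funM => //.
exact: (measurableT_comp (@measurable_expR R) mB).
Qed.

(** Variation of constants: multiplication by the integrating factor exp I
    turns H' + kappa H into an exact derivative. *)
Lemma is_derive_discounted (H dH : R -> R) t s :
  is_derive s (1 : R) H (dH s) ->
  is_derive s (1 : R) (fun x => expR (I x - I t) * H x)
    (expR (I s - I t) * (dH s + kappa s * H s)).
Proof.
move=> dHs.
have dE : is_derive s (1 : R) (fun x => expR (I x - I t)) (kappa s * expR (I s - I t)).
  apply: is_derive_expR_comp; rewrite -[kappa s]subr0.
  apply: is_deriveB; exact: is_derive_cst.
apply: is_derive_eq; rewrite /GRing.scale/=; ring.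
Qed.

Lemma continuous_discounted (H dH : R -> R) t :
  (forall s, is_derive s (1 : R) H (dH s)) -> continuous dH ->
  continuous (fun s => expR (I s - I t) * (dH s + kappa s * H s)).
Proof.
move=> dHs cdH s.
have cI := is_derive_continuous dI.
have cH := is_derive_continuous dHs.
apply: cvgM.
  apply: continuous_comp; last exact: continuous_expR.
  by apply: cvgB; [exact: cI|exact: cvg_cst].
by apply: cvgD; [exact: cdH|apply: cvgM; [exact: ckappa|exact: cH]].
Qed.

(** Comparison with a supersolution H. Integrating the exact derivative of exp
    (I s - I t) H s over [r, t] leaves the boundary term at r,
    which can be dropped because 0 <= H. *)
Lemma duhamel_le (F H dH : R -> R) t :
  measurable_fun setT F -> (forall s, 0 <= F s) ->
  (forall s, is_derive s (1 : R) H (dH s)) -> continuous dH -> (forall s, 0 <= H s) ->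
  (forall s, s <= t -> F s <= dH s + kappa s * H s) ->
  (duhamel I F t <= (H t)%:E)%E.
Proof.
move=> mF F0 dHs cdH H0 FH.
apply: integral_halfline_le.
- exact: measurable_duhamel.
- by move=> s; rewrite mulr_ge0// expR_ge0.
move=> r rt.
apply: (@le_trans _ _ (\int[mu]_(s in `[r, t])
    (expR (I s - I t) * (dH s + kappa s * H s))%:E)%E).
  apply: ge0_le_integral => //.
  - by move=> s _; rewrite lee_fin mulr_ge0// expR_ge0.
  - exact: (measurable_EFin_restr (measurable_duhamel t mF)).
  - have mG := continuous_measurable_fun (continuous_discounted (t := t) dHs cdH).
    exact: (measurable_EFin_restr mG).
  - move=> s; rewrite /= in_itv/= => /andP[_ st].
    by rewrite lee_fin ler_wpM2l ?expR_ge0// FH.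
rewrite (integral_derivative rt (fun s => is_derive_discounted t (dHs s))).
  by rewrite lee_fin subrr expR0 mul1r gerBl mulr_ge0// expR_ge0.
exact: continuous_discounted.
Qed.

(** For a subsolution the boundary term has the wrong sign, hence the
    hypothesis that it becomes small along some sequence of times. *)
Lemma duhamel_ge (F H dH : R -> R) t :
  measurable_fun setT F -> (forall s, 0 <= F s) ->
  (forall s, is_derive s (1 : R) H (dH s)) -> continuous dH ->
  (forall s, s <= t -> dH s + kappa s * H s <= F s) ->
  (forall e, 0 < e -> exists2 s, s < t & expR (I s - I t) * H s <= e) ->
  ((H t)%:E <= duhamel I F t)%E.
Proof.
move=> mF F0 dHs cdH FH He.
apply/lee_addgt0Pr => e e0; have [r rt Hr] := He _ e0.
have H1 : (\int[mu]_(s in `[r, t])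
    (expR (I s - I t) * (dH s + kappa s * H s))%:E <= duhamel I F t)%E.
  apply: (@le_trans _ _ (\int[mu]_(s in `[r, t]) (expR (I s - I t) * F s)%:E)%E).
    apply: integral_le_ge0 => //.
    - exact: continuous_measurable_fun (continuous_discounted (t := t) dHs cdH).
    - exact: measurable_duhamel.
    - by move=> s; rewrite mulr_ge0// expR_ge0.
    - move=> s; rewrite /= in_itv/= => /andP[_ st].
      by rewrite ler_wpM2l ?expR_ge0// FH.
  apply: ge0_subset_integral => //.
  - exact: (measurable_EFin_restr (measurable_duhamel t mF)).
  - by move=> s _; rewrite lee_fin mulr_ge0// expR_ge0.
  - by move=> s; rewrite /= !in_itv/= => /andP[].
apply: (@le_trans _ _ (duhamel I F t + (expR (I r - I t) * H r)%:E)%E); last first.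
  by rewrite leeD2l// lee_fin.
move: H1; rewrite (integral_derivative rt (fun s => is_derive_discounted t (dHs s))).
  by rewrite subrr expR0 mul1r EFinB leeBlDr.
exact: continuous_discounted.
Qed.

End Duhamel.

(** * Regularity of Duhamel integrals *)

Section Primitive.
Context {R : realType}.
Notation mu := (@lebesgue_measure R).

(** Needed when p is not known to be continuous: a fixed point of the integral
    operator is first only measurable along an orbit, this makes it
    continuous, and then the fundamental theorem makes it differentiable. *)
Lemma continuous_halfline_integral (p : R -> R) :
  (forall t, mu.-integrable `]-oo, t] (EFin \o p)) ->
  continuous (fun t => \int[mu]_(s in `]-oo, t]) p s).
Proof.
move=> ip t.
have tt : t - 1 < t + 1 by lra.
have ab : mu.-integrable `[t - 1, t + 1] (EFin \o p).
  apply: integrableS (ip (t + 1)) => //.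
  by move=> x /=; rewrite !in_itv/= => /andP[].
have /(continuous_within_itvP _ tt)[ct _ _] :=
  parameterized_integral_continuous (ltW tt) ab.
have tin : t \in `]t - 1, t + 1[ by rewrite in_itv/=; apply/andP; split; lra.
have {}ct := ct t tin.
pose P x := \int[mu]_(s in `]-oo, x]) p s.
pose Q x := P (t - 1) + parameterized_integral mu (t - 1) x p.
have cQ : Q x @[x --> t] --> Q t by apply: cvgD; [exact: cvg_cst|exact: ct].
have E : \forall x \near t, Q x = P x.
  near=> x.
  have tx : t - 1 <= x by near: x; apply: lt_le_nbhsr; lra.
  rewrite /Q /parameterized_integral /P.
  rewrite -[in RHS](subrK (\int[mu]_(s in `]-oo, t - 1]) p s)
    (\int[mu]_(s in `]-oo, x]) p s)) addrC; congr (_ + _).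
  rewrite Rintegral_itvB//.
  rewrite Rintegral_itv_obnd_cbnd//.
  apply: integrableS (ip x) => //.
  by move=> y /=; rewrite !in_itv/= => /andP[].
move: cQ; rewrite (nbhs_singleton E : Q t = P t) => cQ.
by apply: cvg_trans cQ; apply: near_eq_cvg; apply: filterS E => x /= ->.
Unshelve. all: by end_near. Qed.

Lemma is_derive_halfline_integral (p : R -> R) t :
  (forall t, mu.-integrable `]-oo, t] (EFin \o p)) -> continuous p ->
  is_derive t (1 : R) (fun t => \int[mu]_(s in `]-oo, t]) p s) (p t).
Proof.
move=> ip cp.
have tt : t < t + 1 by lra.
have [d e] := continuous_FTC1 tt (ip (t + 1)) (ltNyr t) (cp t).
by apply: DeriveDef; [exact: d|rewrite -derive1E; exact: e].
Qed.

Lemma ge0_integrable_halfline (p : R -> R) t :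
  measurable_fun setT p -> (forall s, 0 <= p s) ->
  (\int[mu]_(s in `]-oo, t]) (p s)%:E < +oo)%E ->
  mu.-integrable `]-oo, t] (EFin \o p).
Proof.
move=> mp p0 pf; apply/integrableP; split.
  exact: (measurable_EFin_restr mp).
rewrite (le_lt_trans _ pf)// le_eqVlt; apply/orP; left; apply/eqP.
by apply: eq_integral => s _; rewrite /= ger0_norm.
Qed.

Section Duhamel.
Context (kappa I : R -> R).
Hypothesis dI : forall s, is_derive s (1 : R) I (kappa s).
Context (F : R -> R).
Hypotheses (mF : measurable_fun setT F) (F0 : forall s, 0 <= F s).
Hypothesis dF : forall t, (duhamel I F t < +oo)%E.

Let p s := expR (I s) * F s.

Let mp : measurable_fun setT p.
Proof.
have mI := continuous_measurable_fun (is_derive_continuous dI).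
by apply: measurable_funM => //; exact: (measurableT_comp (@measurable_expR R) mI).
Qed.

Let p0 s : 0 <= p s. Proof. by rewrite mulr_ge0// expR_ge0. Qed.

Let duhamelE t :
  duhamel I F t = ((expR (- I t))%:E * \int[mu]_(s in `]-oo, t]) (p s)%:E)%E.
Proof.
rewrite /duhamel -ge0_integralZl//.
- by apply: eq_integral => s _; rewrite expRD -EFinM /p; congr EFin; ring.
- exact: (measurable_EFin_restr mp).
- by move=> s _; rewrite lee_fin.
Qed.

Let ip t : mu.-integrable `]-oo, t] (EFin \o p).
Proof.
apply: ge0_integrable_halfline => //.
have := dF t; rewrite duhamelE.
have : (0 <= \int[mu]_(s in `]-oo, t]) (p s)%:E)%E.
  by apply: integral_ge0 => s _; rewrite lee_fin.
case: (\int[mu]_(s in `]-oo, t]) (p s)%:E)%E => // [r _ _|_].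
  by rewrite ltry.
by rewrite gt0_muley// lte_fin expR_gt0.
Qed.

Let fineE :
  (fun t => fine (duhamel I F t)) =
  (fun t => expR (- I t) * \int[mu]_(s in `]-oo, t]) p s).
Proof.
apply/funext => t; rewrite duhamelE fineM//.
exact: integrable_fin_num (ip t).
Qed.

Lemma continuous_duhamel : continuous (fun t => fine (duhamel I F t)).
Proof.
have cI := is_derive_continuous dI.
rewrite fineE => t; apply: cvgM; last exact: continuous_halfline_integral.
apply: continuous_comp; last exact: continuous_expR.
by apply: cvgN; exact: cI.
Qed.

Lemma is_derive_duhamel t : continuous F ->
  is_derive t (1 : R) (fun t => fine (duhamel I F t))
    (F t - kappa t * fine (duhamel I F t)).
Proof.
move=> cF; have cI := is_derive_continuous dI.
have dE : is_derive t (1 : R) (fun t => expR (- I t)) (- kappa t * expR (- I t)).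
  exact: (is_derive_expR_comp (is_deriveN (dI t))).
have cp : continuous p.
  move=> s; apply: cvgM; last exact: cF.
  by apply: continuous_comp; [exact: cI|exact: continuous_expR].
have dP := is_derive_halfline_integral t ip cp.
have E : fine (duhamel I F t) = expR (- I t) * \int[mu]_(s in `]-oo, t]) p s.
  by have := congr1 (fun f => f t) fineE.
rewrite E fineE; apply: is_derive_eq; rewrite /GRing.scale/= /p.
have : expR (- I t) * expR (I t) = 1 by rewrite -expRD addNr expR0.
by move=> e; ring: e.
Qed.

(** The integral of exp I F over ]-oo, t] is nondecreasing in t, so positivity
    propagates forward in time. *)
Lemma duhamel_gt0 r t : r <= t -> (0 < duhamel I F r)%E -> (0 < duhamel I F t)%E.
Proof.
move=> rt; rewrite !duhamelE.
rewrite !pmule_rgt0 ?lte_fin ?expR_gt0// => /lt_le_trans; apply.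
apply: ge0_subset_integral => //.
- exact: (measurable_EFin_restr mp).
- by move=> s _; rewrite lee_fin.
- by move=> s /=; rewrite !in_itv/= => /le_trans; apply.
Qed.

End Duhamel.
End Primitive.

(** * Oriented integrals and lower means *)

Section OrientedIntegral.
Context {R : realType}.
Notation mu := (@lebesgue_measure R).
Implicit Types f F : R -> R.

Lemma oint_derivative F f s t :
  (forall x, is_derive x (1 : R) F (f x)) -> continuous f ->
  oint f s t = F t - F s.
Proof.
move=> dF cf; have H r x : r <= x -> \int[mu]_(y in `[r, x]) f y = F x - F r.
  rewrite le_eqVlt => /predU1P[->|rx].
    by rewrite subrr set_itv1 Rintegral_set1.
  by rewrite /Rintegral (integral_derivative rx dF).
rewrite /oint; case: ifPn => [/H//|]; rewrite -ltNge => /ltW/H ->.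
by rewrite opprB.
Qed.

(** The base point b is taken to the left of both 0 and t, so that near t the
    oriented integral is a difference of two integrals starting from b. *)
Lemma is_derive_oint f t : continuous f ->
  is_derive t (1 : R) (oint f 0) (f t).
Proof.
move=> cf; pose b := Num.min t 0 - 1.
have bt : b < t by rewrite ltrBlDr (@le_lt_trans _ _ t)// ?ltrDl// ge_min lexx.
have b0 : b < 0 by rewrite ltrBlDr (@le_lt_trans _ _ 0)// ?ltrDl// ge_min lexx orbT.
have intf r x : mu.-integrable `[r, x] (EFin \o f).
  apply: continuous_compact_integrable; first exact: segment_compact.
  exact: continuous_subspaceT.
pose G x := \int[mu]_(y in `[b, x]) f y.
have chasles r x : b <= r -> r <= x -> \int[mu]_(y in `[r, x]) f y = G x - G r.
  move=> br rx; rewrite /G Rintegral_itvB//.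
  rewrite Rintegral_itv_obnd_cbnd//; apply: integrableS (intf b x) => //.
  by move=> y /=; rewrite !in_itv/= => /andP[ry ->]; rewrite (le_trans br (ltW ry)).
have tt : t < t + 1 by rewrite ltrDl.
have [d e] := continuous_FTC1_closed tt (intf b (t + 1)) bt (cf t).
apply: (@near_eq_is_derive _ _ _ (fun x => G x - G 0)).
  near=> x; have bx : b <= x by near: x; apply: lt_le_nbhsr.
  rewrite /oint; case: ifPn => [x0|]; first by rewrite chasles// ltW.
  by rewrite -ltNge => /ltW x0; rewrite chasles// opprB.
rewrite -[f t]subr0; apply: is_deriveB.
by apply: DeriveDef; [exact: d|rewrite -derive1E; exact: e].
Unshelve. all: by end_near. Qed.

Lemma oint_chasles f s t : continuous f -> oint f s t = oint f 0 t - oint f 0 s.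
Proof. by move=> cf; apply: oint_derivative => // x; exact: is_derive_oint. Qed.

Lemma oint00 f : oint f 0 0 = 0.
Proof. by rewrite /oint lexx set_itv1 Rintegral_set1. Qed.

Lemma oint_ge0 f s t : (forall x, 0 <= f x) -> s <= t -> 0 <= oint f s t.
Proof.
by move=> f0 st; rewrite /oint st; apply: Rintegral_ge0.
Qed.

Lemma is_derive_affine (b k x df : R) f : is_derive x (1 : R) f df ->
  is_derive x (1 : R) (fun t => b * t + k * f t) (b + k * df).
Proof.
move=> dx.
have H1 : is_derive x (1 : R) (fun t : R => b * t) b.
  by apply: is_derive_eq; rewrite /GRing.scale/= mulr1.
have H2 : is_derive x (1 : R) (fun t : R => k * f t) (k * df).
  exact: (is_deriveZ k dx).
exact: is_deriveD.
Qed.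

Lemma oint_affine (b k : R) f s t : continuous f ->
  oint (fun x => b + k * f x) s t = b * (t - s) + k * oint f s t.
Proof.
move=> cf.
have dF x := is_derive_affine b k (is_derive_oint x cf).
rewrite (oint_derivative s t dF).
  by rewrite (oint_chasles s t cf); ring.
by move=> x; apply: cvgD; [exact: cvg_cst|apply: cvgM; [exact: cvg_cst|exact: cf]].
Qed.

(** The infimum over windows of length at least r is nondecreasing in r, so
    the limit in the definition of the lower mean is a genuine one. *)
Lemma cvg_lower_mean f :
  ereal_inf (averages f r) @[r --> +oo] --> lower_mean f.
Proof.
have nd : {homo (fun r => ereal_inf (averages f r)) : n m / n <= m >-> (n <= m)%E}.
  move=> n m nm; apply: ereal_inf_le_tmp => _ [s [t [mt ->]]].
  by exists s, t; split => //; exact: le_trans mt.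
have H := nondecreasing_cvge nd.
by rewrite /lower_mean (cvg_lim _ H)//.
Qed.

Lemma lower_mean_ge f (L e : R) : lower_mean f = L%:E -> 0 < e ->
  exists2 r : R, 0 < r &
    forall s t, r <= t - s -> (L - e) * (t - s) <= oint f s t.
Proof.
move=> fL e0; have := @cvg_lower_mean f; rewrite fL.
have Le : ((L - e)%:E < L%:E)%E by rewrite lte_fin ltrBlDr ltrDl.
move=> /(_ _ (open_ereal_gt' Le)) [M [_ HM]]; pose r := Num.max M 0 + 1.
have Mr : M < r by rewrite (@le_lt_trans _ _ (Num.max M 0))// ?ltrDl// le_max lexx.
have r0 : 0 < r.
  by rewrite (@le_lt_trans _ _ (Num.max M 0))// ?ltrDl// le_max lexx orbT.
exists r => // s t rts.
have ts : 0 < t - s by exact: lt_le_trans rts.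
have /= H := HM _ Mr.
have : ((L - e)%:E <= ((t - s)^-1 * oint f s t)%:E)%E.
  apply: (le_trans (ltW H)); apply: ereal_inf_lbound; exists s, t; split => //.
by rewrite lee_fin mulrC ler_pdivlMr.
Qed.

Lemma ereal_inf_affine (S : set \bar R) (b k : R) : 0 < k ->
  ereal_inf [set b%:E + k%:E * x | x in S]%E = (b%:E + k%:E * ereal_inf S)%E.
Proof.
move=> k0; apply/eqP; rewrite eq_le; apply/andP; split; last first.
  apply/ereal_infP => _ [x Sx <-].
  by rewrite leeD2l// lee_pmul2l ?lte_fin//; exact: ereal_inf_lbound.
rewrite -leeBlDl// -lee_pdivrMl//; apply/ereal_infP => x Sx.
by rewrite lee_pdivrMl// leeBlDl//; apply: ereal_inf_lbound; exists x.
Qed.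

Lemma lower_mean_affine f (b k L : R) : continuous f -> 0 < k ->
  lower_mean f = L%:E ->
  lower_mean (fun x => b + k * f x) = (b + k * L)%:E.
Proof.
move=> cf k0 fL; apply/cvg_lim => //.
have H : (b%:E + k%:E * ereal_inf (averages f r))%E @[r --> +oo] -->
    (b + k * L)%:E.
  rewrite EFinD EFinM -fL; apply: cvgeD; first by rewrite fL.
    exact: cvg_cst.
  by apply: cvgeZl => //; exact: cvg_lower_mean.
apply: cvg_trans H; apply: near_eq_cvg; near=> r.
rewrite -ereal_inf_affine//; congr ereal_inf.
have r0 : 0 < r by near: r; exact: nbhs_pinfty_gt.
have E s t : r <= t - s -> (b%:E + k%:E * ((t - s)^-1 * oint f s t)%:E)%E =
    ((t - s)^-1 * oint (fun x => b + k * f x) s t)%:E.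
  move=> rts; have ts : t - s != 0 by rewrite gt_eqF// (lt_le_trans r0).
  by rewrite oint_affine// -EFinM -EFinD; congr EFin; field.
apply/seteqP; split => [_ [_ [s [t [rts ->]]] <-]|_ [s [t [rts ->]]]].
  by exists s, t; split => //; rewrite E.
by exists ((t - s)^-1 * oint f s t)%:E; [exists s, t|rewrite E].
Unshelve. all: by end_near. Qed.

End OrientedIntegral.

(** * Bounded correctors *)

Section Corrector.
Context {R : realType}.

(** If I grows at least linearly, the discount factor from a remote past is
    arbitrarily small; the witness s = t - y is found by solving c - eps y <=
    ln e. *)
Lemma vanishing_discount (I : R -> R) (eps c t e : R) : 0 < eps -> 0 < e ->
  (forall s, s <= t -> eps * (t - s) - c <= I t - I s) ->
  exists2 s, s < t & expR (I s - I t) <= e.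
Proof.
move=> eps0 e0 HI; pose y := (`|c - ln e| + 1) / eps.
have y0 : 0 < y by rewrite divr_gt0// ltr_wpDl.
exists (t - y); first by rewrite ltrBlDr ltrDl.
rewrite -[leRHS]lnK ?posrE// ler_expR.
have : t - y <= t by rewrite gerBl ltW.
move=> /HI; rewrite (_ : t - (t - y) = y); last by ring.
have -> : eps * y = `|c - ln e| + 1 by rewrite /y; field; rewrite gt_eqF.
have := ler_norm (c - ln e); lra.
Qed.

(** The solution D of D' + (k alpha - h) D = alpha that starts from 0 at -oo.
    Comparison with the constant 1 / k gives the lower bound. For the upper
    bound the supersolution is 1 / k plus a multiple of exp (k C - eps (t - s)
    + I t - I s), eps = k b - h: the exponent is nonnegative by the lower
    bound on the averages of alpha, which compensates the term h / k, and it
    equals k C at s = t, which does not depend on t. *)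
Lemma corrector (alpha : R -> R) (k h b C : R) :
  continuous alpha -> (forall t, 0 <= alpha t) -> 0 < k -> 0 <= h -> h < k * b ->
  (forall s t, s <= t -> b * (t - s) - C <= oint alpha s t) ->
  exists (D dD : R -> R) (M : R),
    [/\ forall t, is_derive t (1 : R) D (dD t), continuous dD,
        forall t, k^-1 <= D t <= M &
        forall t, dD t + (k * alpha t - h) * D t = alpha t].
Proof.
move=> ca a0 k0 h0 hkb Hb.
pose kappa t := - h + k * alpha t.
pose I t := - h * t + k * oint alpha 0 t.
have dI s : is_derive s (1 : R) I (kappa s).
  by apply: is_derive_affine; exact: is_derive_oint.
have ckappa : continuous kappa.
  by move=> s; apply: cvgD; [exact: cvg_cst|apply: cvgM; [exact: cvg_cst|exact: ca]].
pose eps := k * b - h; have eps0 : 0 < eps by rewrite subr_gt0.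
have HI s t : s <= t -> eps * (t - s) - k * C <= I t - I s.
  move=> st; have := Hb _ _ st; rewrite (oint_chasles _ _ ca) => H.
  have {}H := ler_wpM2l (ltW k0) H.
  rewrite /I /eps; move: H; lra.
pose M := k^-1 + h / (k * eps) * expR (k * C).
have ma := continuous_measurable_fun ca.
have up t : (duhamel I alpha t <= M%:E)%E.
  pose E s := k * C - eps * (t - s) + (I t - I s).
  pose c := h / (k * eps).
  have c0 : 0 <= c by rewrite divr_ge0// mulr_ge0// ltW.
  have dE s : is_derive s (1 : R) E (eps - kappa s).
    have E1 : is_derive s (1 : R) (fun s : R => (k * C - eps * t + I t) + eps * s) (0 + eps).
      apply: is_deriveD; apply: is_derive_eq; by rewrite /GRing.scale/= mulr1.
    have -> : E = fun s : R => ((k * C - eps * t + I t) + eps * s) - I s.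
      by apply/funext => x; rewrite /E; ring.
    by have := is_deriveB E1 (dI s); rewrite add0r.
  pose H s := k^-1 + c * expR (E s).
  pose dH s := c * ((eps - kappa s) * expR (E s)).
  have dHs s : is_derive s (1 : R) H (dH s).
    have d1 := is_deriveZ c (is_derive_expR_comp (dE s)).
    have := is_deriveD (is_derive_cst k^-1 s (1 : R)) d1.
    by rewrite add0r.
  have cE := is_derive_continuous dE.
  have cdH : continuous dH.
    move=> s; apply: cvgM; first exact: cvg_cst.
    apply: cvgM; first by apply: cvgB; [exact: cvg_cst|exact: ckappa].
    by apply: continuous_comp; [exact: cE|exact: continuous_expR].
  have H0 s : 0 <= H s.
    by apply: addr_ge0; [rewrite invr_ge0 ltW|rewrite mulr_ge0// expR_ge0].
  have -> : M = H t by rewrite /M /H /E !subrr mulr0 subr0 addr0.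
  apply: (duhamel_le dI ckappa ma a0 dHs cdH H0) => s st.
  have E1 : 1 <= expR (E s).
    rewrite -expR0 ler_expR /E; have := HI _ _ st; lra.
  have -> : dH s + kappa s * H s = alpha s + (h / k) * (expR (E s) - 1).
    by rewrite /dH /H /c /kappa; field; rewrite !gt_eqF.
  by rewrite lerDl mulr_ge0// ?subr_ge0// divr_ge0// ltW.
have lo t : ((k^-1)%:E <= duhamel I alpha t)%E.
  apply: (@duhamel_ge _ kappa I dI ckappa alpha (cst k^-1) (cst 0)) => //.
  - by move=> s; exact: cvg_cst.
  - move=> s st; rewrite /cst add0r /kappa mulrDl mulrAC divff ?gt_eqF// mul1r.
    by rewrite gerDr mulNr oppr_le0 divr_ge0// ltW.
  - move=> e e0; have ke : 0 < k * e by rewrite mulr_gt0.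
    have [s st Hs] := vanishing_discount eps0 ke (fun s st => HI s t st).
    by exists s => //; rewrite /cst ler_pdivrMr// mulrC.
have fin t : (duhamel I alpha t < +oo)%E by rewrite (le_lt_trans (up t))// ltry.
have num t : duhamel I alpha t \is a fin_num.
  by rewrite ge0_fin_numE//; apply: le_trans (lo t); rewrite lee_fin invr_ge0 ltW.
pose D t := fine (duhamel I alpha t).
exists D, (fun t => alpha t - kappa t * D t), M; split.
- by move=> t; exact: (is_derive_duhamel dI ma a0 fin).
- move=> t; apply: cvgB; first exact: ca.
  apply: cvgM; first exact: ckappa.
  exact: (continuous_duhamel dI ma a0 fin).
- move=> t; have := lo t; have := up t; rewrite -(fineK (num t)) !lee_fin.
  by move=> -> ->.
- by move=> t; rewrite /kappa; ring.
Qed.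

End Corrector.

(** * Joint measurability of parameter integrals *)

Section JointMeasurability.
Context {R : realType}.
Notation leb := (@lebesgue_measure R).

(** The domain of integration D x may depend on the parameter; it is turned
    into a factor of the integrand before Tonelli applies. *)
Lemma measurable_fun_integral_section d (T : measurableType d)
    (f : T -> R -> R) (D : T -> pred R) :
  measurable_fun setT (fun p : T * measurableTypeR R => f p.1 p.2) ->
  (forall x s, 0 <= f x s) ->
  measurable_fun setT (fun p : T * measurableTypeR R => D p.1 p.2) ->
  measurable_fun setT
    (fun x => fine (\int[leb]_(s in [set s | D x s]) (f x s)%:E)%E).
Proof.
move=> mf f0 mD.
pose g (p : T * measurableTypeR R) : \bar R :=
  if D p.1 p.2 then (f p.1 p.2)%:E else 0%E.
have mg : measurable_fun setT g.
  by apply: measurable_fun_ifT => //; apply/measurable_EFinP.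
have g0 p : (0 <= g p)%E by rewrite /g; case: ifP => // _; rewrite lee_fin.
have H := measurable_fun_fubini_tonelli_F (m2 := leb) g mg g0.
apply: measurableT_comp; first exact: fine_measurable.
rewrite (_ : (fun x => _) = fubini_F leb g)//.
apply/funext => x; rewrite /fubini_F [LHS]integral_mkcond.
apply: eq_integral => s _; rewrite /g/= patchE.
by case: ifPn; rewrite ?inE /=; [move=> ->|move/negP; rewrite inE => /negP/negbTE ->].
Qed.

Lemma measurable_oint d (Omega : measurableType d) (f : R -> Omega -> R) :
  measurable_fun setT (fun p : measurableTypeR R * Omega => f p.1 p.2) ->
  (forall s w, 0 <= f s w) ->
  measurable_fun setT
    (fun p : measurableTypeR R * Omega => oint (f ^~ p.2) 0 p.1).
Proof.
move=> mf f0.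
have m1 : measurable_fun setT
    (fun q : (measurableTypeR R * Omega) * measurableTypeR R => q.1.1 : R).
  exact: (measurableT_comp measurable_fst measurable_fst).
have m2 : measurable_fun setT
    (fun q : (measurableTypeR R * Omega) * measurableTypeR R => q.1.2).
  exact: (measurableT_comp measurable_snd measurable_fst).
have m3 : measurable_fun setT
    (fun q : (measurableTypeR R * Omega) * measurableTypeR R => q.2 : R).
  exact: measurable_snd.
have mF : measurable_fun setT
    (fun q : (measurableTypeR R * Omega) * measurableTypeR R => f q.2 q.1.2).
  exact: (measurableT_comp mf (measurable_fun_pair m3 m2)).
have m0 : measurable_fun setT
    (fun q : (measurableTypeR R * Omega) * measurableTypeR R => (0 : R)).
  exact: measurable_cst.
apply: measurable_fun_ifT.
- apply: measurable_fun_ler; [exact: measurable_cst|exact: measurable_fst].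
- pose D (p : measurableTypeR R * Omega) : pred R := fun s => 0 <= s <= p.1.
  have := @measurable_fun_integral_section _ _ (fun p s => f s p.2) D mF.
  move=> /(_ (fun p s => f0 s p.2)); apply.
  by apply: measurable_and; apply: measurable_fun_ler.
- apply: measurable_funN.
  pose D (p : measurableTypeR R * Omega) : pred R := fun s => p.1 <= s <= 0.
  have := @measurable_fun_integral_section _ _ (fun p s => f s p.2) D mF.
  move=> /(_ (fun p s => f0 s p.2)); apply.
  by apply: measurable_and; apply: measurable_fun_ler.
Qed.

End JointMeasurability.

(** * The monotone integral operator *)

(** A measurable flow with a positive measurable rate; the local Hoelder
    condition enters as continuity of the rate along orbits. *)
Record environment {R : realType} {d : measure_display}
    {Omega : measurableType d} (theta : R -> Omega -> Omega) (a : Omega -> R) :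
    Prop := Environment {
  flow_measurable : measurable_fun setT
    (fun p : measurableTypeR R * Omega => theta p.1 p.2) ;
  flow0 : forall w, theta 0 w = w ;
  flowD : forall s t w, theta (s + t) w = theta s (theta t w) ;
  rate_measurable : measurable_fun setT a ;
  rate_gt0 : forall w, 0 < a w ;
  rate_continuous : forall w, continuous (fun t => a (theta t w)) }.

Section Step.
Context {R : realType} {d : measure_display} {Omega : measurableType d}.
Context (theta : R -> Omega -> Omega) (a : Omega -> R) (mu : R).
Notation leb := (@lebesgue_measure R).
Implicit Types (Psi : R -> Omega -> R) (w : Omega) (x s t : R).

(** The symbol of the discrete Laplacian: it maps exp (- m i) to lap m * exp
    (- m i). *)
Definition lap (m : R) : R := expR m + expR (- m) - 2.

Definition growth w t : R := oint (fun s => a (theta s w)) 0 t.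

(** The primitive of the killing rate 2 + a: the 2 is the diagonal of the
    discrete Laplacian, and a comes from the linear part of the reaction term
    a Psi (1 - Psi). *)
Definition decay w t : R := 2 * t + growth w t.

Definition displacement w t : R := oint (fun s => speed (a (theta s w)) mu) 0 t.

(** The gain term of the equation for 1 - Phi at the sites x - 1, x, x + 1, in
    the frame of the front. It is nondecreasing in Psi. *)
Definition source Psi x w s : R :=
  Psi (x + 1 - displacement w s) (theta s w)
  + Psi (x - 1 - displacement w s) (theta s w)
  + a (theta s w) * Psi (x - displacement w s) (theta s w) ^+ 2.

(** The Duhamel operator at time 0; evaluating it at theta t w moves the
    observation time to t. *)
Definition step Psi x w : R :=
  fine (\int[leb]_(s in `]-oo, 0%R]) (expR (decay w s) * source Psi x w s)%:E)%E.

Hypothesis env : environment theta a.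
Hypothesis mu_gt0 : 0 < mu.

Let theta_meas := flow_measurable env.
Let theta0 := flow0 env.
Let thetaD := flowD env.
Let a_meas := rate_measurable env.
Let a_gt0 := rate_gt0 env.
Let a_cont := rate_continuous env.

Lemma lap_gt0 (m : R) : m != 0 -> 0 < lap m.
Proof.
move=> m0; have := expR_gt1Dx m0; have := @expR_gt1Dx R (- m).
by rewrite oppr_eq0 => /(_ m0); rewrite /lap; lra.
Qed.

Lemma speedE (alpha m : R) : speed alpha m = lap m / m + m^-1 * alpha.
Proof. by rewrite /speed /lap mulrDl [alpha / m]mulrC. Qed.

Lemma displacementE w t : displacement w t = (lap mu * t + growth w t) / mu.
Proof.
rewrite /displacement (_ : (fun s => _) =
  fun s => lap mu / mu + mu^-1 * a (theta s w)); last first.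
  by apply/funext => s; rewrite speedE.
by rewrite oint_affine// /growth; field; rewrite gt_eqF.
Qed.

Lemma is_derive_growth w t : is_derive t (1 : R) (growth w) (a (theta t w)).
Proof. exact: (is_derive_oint t (@a_cont w)). Qed.

Lemma is_derive_decay w t : is_derive t (1 : R) (decay w) (2 + a (theta t w)).
Proof.
have := is_derive_affine 2 1 (is_derive_growth w t).
by rewrite mul1r; under eq_fun do rewrite mul1r.
Qed.

Lemma continuous_rate w : continuous (fun t => 2 + a (theta t w)).
Proof. by move=> s; apply: cvgD; [exact: cvg_cst|exact: a_cont]. Qed.

Lemma is_derive_displacement w t :
  is_derive t (1 : R) (displacement w) (speed (a (theta t w)) mu).
Proof.
have := is_derive_affine (lap mu / mu) mu^-1 (is_derive_growth w t).
rewrite -speedE; congr (is_derive _ _ _ _); apply/funext => s.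
by rewrite displacementE; field; rewrite gt_eqF.
Qed.

(** This cocycle property and the next two make the operator commute with the
    flow. *)
Lemma growth_cocycle w t s :
  growth (theta t w) s = growth w (t + s) - growth w t.
Proof.
rewrite {1}/growth.
have dF x : is_derive x (1 : R) (fun x => growth w (t + x)) (a (theta x (theta t w))).
  rewrite -thetaD addrC -[a _]mulr1.
  apply: (@is_derive1_comp _ (growth w) (fun x => t + x)).
    exact: is_derive_growth.
  have := is_deriveD (is_derive_cst t x (1 : R)) (is_derive_id x (1 : R)).
  by rewrite add0r.
by rewrite (oint_derivative _ _ dF (@a_cont (theta t w))) addr0.
Qed.

Lemma decay_cocycle w t s : decay (theta t w) s = decay w (t + s) - decay w t.
Proof. by rewrite /decay growth_cocycle; ring. Qed.

Lemma displacement_cocycle w t s :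
  displacement (theta t w) s = displacement w (t + s) - displacement w t.
Proof. by rewrite !displacementE growth_cocycle; field; rewrite gt_eqF. Qed.

Lemma growth0 w : growth w 0 = 0. Proof. exact: oint00. Qed.
Lemma decay0 w : decay w 0 = 0.
Proof. by rewrite /decay growth0 mulr0 addr0. Qed.
Lemma displacement0 w : displacement w 0 = 0.
Proof. exact: oint00. Qed.

Lemma growth_le w s t : s <= t -> growth w s <= growth w t.
Proof.
move=> st; rewrite -subr_ge0 /growth -(oint_chasles s t (@a_cont w)).
by apply: oint_ge0 => // x; rewrite ltW.
Qed.

Lemma decay_le w s t : s <= t -> 2 * (t - s) - 0 <= decay w t - decay w s.
Proof. by move=> /(growth_le w); rewrite /decay; lra. Qed.

(** Joint measurability in (x, w), and not only in w for each x, is required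
    for the operator to be iterated: the argument of Psi moves with the front.
    *)
Definition admissible Psi :=
  measurable_fun setT (fun p : measurableTypeR R * Omega => Psi p.1 p.2) /\
  forall x w, 0 <= Psi x w <= 1.

Lemma measurable_growth :
  measurable_fun setT (fun p : measurableTypeR R * Omega => growth p.2 p.1).
Proof.
apply: (@measurable_oint R _ Omega (fun s w => a (theta s w))).
  exact: (measurableT_comp a_meas theta_meas).
by move=> s w; rewrite ltW.
Qed.

Lemma measurable_displacement :
  measurable_fun setT (fun p : measurableTypeR R * Omega => displacement p.2 p.1).
Proof.
under eq_fun do rewrite displacementE.
apply: measurable_funM; last exact: measurable_cst.
apply: measurable_funD; last exact: measurable_growth.
by apply: measurable_funM; [exact: measurable_cst|exact: measurable_fst].
Qed.

Lemma measurable_decay :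
  measurable_fun setT (fun p : measurableTypeR R * Omega => decay p.2 p.1).
Proof.
apply: measurable_funD; last exact: measurable_growth.
by apply: measurable_funM; [exact: measurable_cst|exact: measurable_fst].
Qed.

Lemma measurable_source Psi d' (T : measurableType d')
    (fx : T -> R) (fw : T -> Omega) (fs : T -> R) : admissible Psi ->
  measurable_fun setT fx -> measurable_fun setT fw -> measurable_fun setT fs ->
  measurable_fun setT (fun p => source Psi (fx p) (fw p) (fs p)).
Proof.
move=> [mPsi _] mx mw ms.
have mth : measurable_fun setT (fun p => theta (fs p) (fw p)).
  exact: (measurableT_comp theta_meas (measurable_fun_pair ms mw)).
have mdis : measurable_fun setT (fun p => displacement (fw p) (fs p)).
  exact: (measurableT_comp measurable_displacement (measurable_fun_pair ms mw)).
have mP (f : T -> R) : measurable_fun setT f ->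
    measurable_fun setT (fun p => Psi (f p - displacement (fw p) (fs p))
      (theta (fs p) (fw p))).
  move=> mf; apply: (measurableT_comp mPsi (measurable_fun_pair _ mth)).
  exact: measurable_funB.
apply: measurable_funD; first apply: measurable_funD.
- by apply: (mP (fun p => fx p + 1)); apply: measurable_funD.
- by apply: (mP (fun p => fx p - 1)); apply: measurable_funB.
apply: measurable_funM; first exact: (measurableT_comp a_meas mth).
by apply: measurable_funX; exact: mP.
Qed.

Lemma source_ge0 Psi x w s : admissible Psi -> 0 <= source Psi x w s.
Proof.
move=> [_ P]; have P0 y v : 0 <= Psi y v by case/andP: (P y v).
by rewrite /source !addr_ge0// mulr_ge0// ?sqr_ge0// ltW.
Qed.

Lemma measurable_source_orbit Psi x w : admissible Psi ->
  measurable_fun setT (source Psi x w).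
Proof.
move=> P; apply: (@measurable_source Psi _ R (cst x) (cst w) id) => //.
Qed.

(** By the cocycle property and translation invariance of the Lebesgue
    measure, the operator at theta t w is the Duhamel integral at time t along
    the orbit of w. *)
Lemma step_orbit Psi x w t : admissible Psi ->
  step Psi (x - displacement w t) (theta t w) =
  fine (duhamel (decay w) (source Psi x w) t).
Proof.
move=> P; rewrite /step /duhamel; congr fine.
pose f s := (expR (decay w s - decay w t) * source Psi x w s)%:E.
rewrite -(@ge0_integral_translation _ f t).
- apply: eq_integral => s _; rewrite /f decay_cocycle /source.
  rewrite displacement_cocycle -!thetaD [s + t]addrC.
  congr (_ * (Psi _ _ + Psi _ _ + _ * Psi _ _ ^+ 2))%:E; ring.
- apply/measurable_EFinP.
  exact: (measurable_duhamel (is_derive_decay w) t (measurable_source_orbit x w P)).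
- by move=> s; rewrite lee_fin mulr_ge0// ?expR_ge0// source_ge0.
Qed.

(** The constant 1 is a supersolution since kappa = 2 + a bounds the gain term
    of any function with values in [0, 1]. *)
Lemma duhamel_source_le1 Psi x w t : admissible Psi ->
  (duhamel (decay w) (source Psi x w) t <= 1%:E)%E.
Proof.
move=> P; have [_ P01] := P.
apply: (@duhamel_le _ _ _ (is_derive_decay w) (@continuous_rate w) _ (cst 1) (cst 0) t) => //.
- exact: measurable_source_orbit.
- by move=> s; exact: source_ge0.
- by move=> s; exact: cvg_cst.
- move=> s _; rewrite /cst add0r mulr1 /source lerD//; last first.
    rewrite -[leRHS]mulr1; apply: ler_wpM2l; first exact: ltW.
    by have /andP[p0 p1] := P01 (x - displacement w s) (theta s w); rewrite expr_le1.
  rewrite -[2]/(1 + 1) lerD//; first by case/andP: (P01 (x + 1 - displacement w s) (theta s w)).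
  by case/andP: (P01 (x - 1 - displacement w s) (theta s w)).
Qed.

Lemma duhamel_source_fin Psi x w t : admissible Psi ->
  duhamel (decay w) (source Psi x w) t \is a fin_num.
Proof.
move=> P; rewrite ge0_fin_numE; last first.
  by apply: integral_ge0 => s _; rewrite lee_fin mulr_ge0// ?expR_ge0// source_ge0.
by rewrite (le_lt_trans (duhamel_source_le1 _ _ _ P))// ltry.
Qed.

Lemma stepE Psi x w : admissible Psi ->
  (step Psi x w)%:E = duhamel (decay w) (source Psi x w) 0.
Proof.
move=> P; have := step_orbit x w 0 P; rewrite displacement0 subr0 theta0 => ->.
by rewrite fineK// duhamel_source_fin.
Qed.

Lemma step_admissible Psi : admissible Psi -> admissible (step Psi).
Proof.
move=> P; split.
  pose f (p : measurableTypeR R * Omega) s :=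
    expR (decay p.2 s) * source Psi p.1 p.2 s.
  pose D (p : measurableTypeR R * Omega) : pred R := fun s => s <= 0.
  have -> : (fun p : measurableTypeR R * Omega => step Psi p.1 p.2) =
      (fun p => fine (\int[leb]_(s in [set s | D p s]) (f p s)%:E)%E).
    by apply/funext => p; rewrite /step; congr (fine (integral _ _ _)).
  apply: measurable_fun_integral_section.
  - have m1 : measurable_fun setT
        (fun q : (measurableTypeR R * Omega) * measurableTypeR R => q.1.1 : R).
      exact: (measurableT_comp measurable_fst measurable_fst).
    have m2 : measurable_fun setT
        (fun q : (measurableTypeR R * Omega) * measurableTypeR R => q.1.2).
      exact: (measurableT_comp measurable_snd measurable_fst).
    have m3 : measurable_fun setT
        (fun q : (measurableTypeR R * Omega) * measurableTypeR R => q.2 : R).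
      exact: measurable_snd.
    apply: measurable_funM; last exact: measurable_source.
    apply: (measurableT_comp (@measurable_expR R)).
    exact: (measurableT_comp measurable_decay (measurable_fun_pair m3 m2)).
  - by move=> p s; rewrite mulr_ge0// ?expR_ge0// source_ge0.
  - by apply: measurable_fun_ler; [exact: measurable_snd|exact: measurable_cst].
move=> x w; have E := stepE x w P.
rewrite -!lee_fin E duhamel_source_le1// andbT.
by apply: integral_ge0 => s _; rewrite lee_fin mulr_ge0// ?expR_ge0// source_ge0.
Qed.

Lemma source_le Psi Psi' x w s : admissible Psi ->
  (forall y v, Psi y v <= Psi' y v) -> source Psi x w s <= source Psi' x w s.
Proof.
move=> [_ P] PP'; rewrite /source !lerD//; apply: ler_wpM2l; first exact: ltW.
apply: lerXn2r => //.
  by rewrite nnegrE; case/andP: (P (x - displacement w s) (theta s w)).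
rewrite nnegrE; apply: le_trans (PP' _ _).
by case/andP: (P (x - displacement w s) (theta s w)).
Qed.

Lemma duhamel_mono (F F' : R -> R) w t :
  measurable_fun setT F -> measurable_fun setT F' -> (forall s, 0 <= F s <= F' s) ->
  (duhamel (decay w) F t <= duhamel (decay w) F' t)%E.
Proof.
move=> mF mF' FF'.
apply: integral_le_ge0 => //.
- exact: (measurable_duhamel (is_derive_decay w)).
- exact: (measurable_duhamel (is_derive_decay w)).
- move=> s; rewrite mulr_ge0 ?expR_ge0//.
  by case/andP: (FF' s) => /le_trans; apply.
- by move=> s _; rewrite ler_wpM2l ?expR_ge0//; case/andP: (FF' s).
Qed.

(** The arguments x and x' may differ: with Psi = Psi' the lemma propagates
    monotonicity in x, with x = x' it gives monotonicity of the operator. *)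
Lemma step_le Psi Psi' x x' w : admissible Psi -> admissible Psi' ->
  (forall s, source Psi x w s <= source Psi' x' w s) ->
  step Psi x w <= step Psi' x' w.
Proof.
move=> P P' PP'; rewrite -lee_fin !stepE//.
apply: duhamel_mono => [||s]; try exact: measurable_source_orbit.
by rewrite source_ge0//=.
Qed.

End Step.

(** * The profile as a limit of iterates *)

Section Profile.
Context {R : realType} {d : measure_display} {Omega : measurableType d}.
Context (theta : R -> Omega -> Omega) (a : Omega -> R) (mu : R).
Notation leb := (@lebesgue_measure R).
Implicit Types (Psi : R -> Omega -> R) (w : Omega) (x s t : R).
Hypothesis env : environment theta a.
Hypothesis mu_gt0 : 0 < mu.

Let a_gt0 := rate_gt0 env.
Let a_cont := rate_continuous env.

Notation step := (step theta a mu).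
Notation source := (source theta a mu).
Notation displacement := (displacement theta a mu).
Notation decay := (decay theta a).

(** In the frame of the front, exp (- mu x) is an exact solution of the
    equation for Phi linearised at 0; the truncation keeps 1 - exp (- mu x)
    in [0, 1]. *)
Definition barrier x : R := Num.max 0 (1 - expR (- mu * x)).

Definition iterate n : R -> Omega -> R := iter n step (fun x _ => barrier x).

Lemma iterateS n : iterate n.+1 = step (iterate n).
Proof. by []. Qed.

Lemma barrier_ge0 x : 0 <= barrier x.
Proof. by rewrite /barrier le_max lexx. Qed.

Lemma barrier_ge x : 1 - expR (- mu * x) <= barrier x.
Proof. by rewrite /barrier le_max lexx orbT. Qed.

Lemma barrier_admissible : admissible (fun x (_ : Omega) => barrier x).
Proof.
split; last first.
  move=> x w; rewrite barrier_ge0/= /barrier ge_max ler01/= gerBl; exact: expR_ge0.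
have mb : measurable_fun setT barrier.
  apply: measurable_maxr; first exact: measurable_cst.
  apply: measurable_funB; first exact: measurable_cst.
  apply: (measurableT_comp (@measurable_expR R)).
  exact: measurable_funM.
exact: (measurableT_comp mb measurable_fst).
Qed.

Lemma barrier_nondecreasing : {homo barrier : x y / x <= y}.
Proof.
move=> x y xy; rewrite /barrier ge_max !le_max lexx/=; apply/orP; right.
by rewrite lerD2l lerN2 ler_expR !mulNr lerN2 ler_pM2l.
Qed.

Lemma iterate_admissible n : admissible (iterate n).
Proof.
elim: n => [|n IH]; first exact: barrier_admissible.
by rewrite iterateS; exact: (step_admissible env mu_gt0 IH).
Qed.

(** A travelling exponential of rate m, seen from a fixed site: the front
    moves at speed c, so that its logarithmic derivative is m c. *)
Lemma is_derive_wave (m : R) x w t :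
  is_derive t (1 : R) (fun s => expR (- m * (x - displacement w s)))
    (m * speed (a (theta t w)) mu * expR (- m * (x - displacement w t))).
Proof.
have dX := is_derive_affine 0 m (is_derive_displacement env mu_gt0 w t).
have := is_deriveD (is_derive_cst (- m * x) t (1 : R)) dX.
rewrite !add0r => dE; apply: is_derive_expR_comp.
have -> : (fun s => - m * (x - displacement w s)) =
    (fun s => - m * x + (0 * s + m * displacement w s)).
  by apply/funext => s; ring.
exact: dE.
Qed.

Lemma continuous_wave (m : R) x w :
  continuous (fun s => expR (- m * (x - displacement w s))).
Proof. exact: (is_derive_continuous (is_derive_wave m x w)). Qed.

Lemma continuous_speed w : continuous (fun s => speed (a (theta s w)) mu).
Proof.
have -> : (fun s => speed (a (theta s w)) mu) =
    fun s => lap mu / mu + mu^-1 * a (theta s w).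
  by apply/funext => s; rewrite speedE.
by move=> s; apply: cvgD; [exact: cvg_cst|apply: cvgM; [exact: cvg_cst|exact: a_cont]].
Qed.

(** The truncated function 1 - v satisfies the same quadratic lower bound as
    the untruncated one. *)
Lemma sqr_ge_tangent (v b : R) : 0 <= v -> 0 <= b -> 1 - v <= b ->
  1 - 2 * v <= b ^+ 2.
Proof.
move=> v0 b0 bv; have [v1|v1] := leP v 1; last by have := sqr_ge0 b; lra.
have : (1 - v) ^+ 2 <= b ^+ 2 by rewrite lerXn2r ?nnegrE// subr_ge0.
have -> : (1 - v) ^+ 2 = 1 - 2 * v + v ^+ 2 by ring.
by have := sqr_ge0 v; lra.
Qed.

(** With v = exp (- mu z), the time derivative of v is (lap mu + al) v, and
    the left-hand side is H' + kappa H for H = 1 - v. *)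
Lemma linear_subsolution (v al p q r : R) :
  1 - expR (- mu) * v <= p -> 1 - expR mu * v <= q ->
  al * (1 - 2 * v) <= al * r ->
  - ((lap mu + al) * v) + (2 + al) * (1 - v) <= p + q + al * r.
Proof. by rewrite /lap => H1 H2 H3; lra. Qed.

(** The function H = 1 - exp (- mu (x - C(s))) is a subsolution along the
    orbit, and the boundary term at -oo vanishes because H <= 1 while the
    decay is at least 2 (t - s). *)
Lemma barrier_le_step x w : barrier x <= step (fun x _ => barrier x) x w.
Proof.
have ad := barrier_admissible.
have : 0 <= step (fun x _ => barrier x) x w /\
    1 - expR (- mu * x) <= step (fun x _ => barrier x) x w; last first.
  by case=> H1 H2; rewrite {1}/barrier ge_max H1 H2.
split; first by case/andP: ((step_admissible env mu_gt0 ad).2 x w).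
rewrite -lee_fin (stepE env mu_gt0)//.
pose V s := expR (- mu * (x - displacement w s)).
pose dV s := mu * speed (a (theta s w)) mu * V s.
have cdV : continuous dV.
  move=> s; apply: cvgM; last exact: continuous_wave.
  by apply: cvgM; [exact: cvg_cst|exact: continuous_speed].
have V0 : 1 - expR (- mu * x) = 1 - V 0 by rewrite /V displacement0 subr0.
rewrite V0.
apply: (@duhamel_ge _ _ _ (is_derive_decay env w) (@continuous_rate _ _ _ _ _ env w)
   _ (fun s => 1 - V s) (fun s => - dV s)).
- exact: (measurable_source_orbit env mu_gt0).
- by move=> s; exact: (source_ge0 mu env).
- move=> s; have := is_deriveB (is_derive_cst (1 : R) s (1 : R)) (is_derive_wave mu x w s).
  by rewrite add0r.
- by move=> s; apply: cvgN; exact: cdV.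
- move=> s _; rewrite /source.
  set al := a _; set z := x - displacement w s.
  have al0 : 0 <= al by exact: ltW (a_gt0 _).
  have H1 : 1 - expR (- mu) * V s <= barrier (x + 1 - displacement w s).
    have -> : expR (- mu) * V s = expR (- mu * (x + 1 - displacement w s)).
      by rewrite /V -expRD; congr expR; ring.
    exact: barrier_ge.
  have H2 : 1 - expR mu * V s <= barrier (x - 1 - displacement w s).
    have -> : expR mu * V s = expR (- mu * (x - 1 - displacement w s)).
      by rewrite /V -expRD; congr expR; ring.
    exact: barrier_ge.
  have H3 := sqr_ge_tangent (expR_ge0 _) (barrier_ge0 z) (barrier_ge z).
  have {}H3 := ler_wpM2l al0 H3.
  have -> : dV s = (lap mu + al) * V s.
    by rewrite /dV speedE -/al; field; rewrite gt_eqF.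
  exact: linear_subsolution H1 H2 H3.
- move=> e e0.
  have lin s : s <= 0 -> 2 * (0 - s) - 0 <= decay w 0 - decay w s.
    exact: (decay_le env).
  have [s s0 Hs] := vanishing_discount (ltr0Sn R 1) e0 lin.
  exists s => //; apply: le_trans Hs; rewrite -[leRHS]mulr1 ler_wpM2l ?expR_ge0//.
  by rewrite gerBl expR_ge0.
Qed.

Lemma iterate_nondecreasing_step x w n : iterate n x w <= iterate n.+1 x w.
Proof.
elim: n x w => [|n IH] x w; first exact: barrier_le_step.
rewrite [in leLHS]iterateS [in leRHS]iterateS.
apply: (step_le env mu_gt0 (iterate_admissible n) (iterate_admissible n.+1)) => s.
exact: (source_le mu env x w s (iterate_admissible n) IH).
Qed.

Lemma iterate_nondecreasing x w : nondecreasing_seq (fun n => iterate n x w).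
Proof. by apply/nondecreasing_seqP => n; exact: iterate_nondecreasing_step. Qed.

Lemma iterate_monotone n w : {homo (fun x => iterate n x w) : x y / x <= y}.
Proof.
elim: n w => [|n IH] w x y xy; first exact: barrier_nondecreasing.
rewrite iterateS.
apply: (step_le env mu_gt0 (iterate_admissible n) (iterate_admissible n)) => s.
have I01 z v := (iterate_admissible n).2 z v.
rewrite /source !lerD//.
- by apply: IH; rewrite !lerD2r.
- by apply: IH; rewrite !lerD2r.
apply: ler_wpM2l; first exact: ltW.
apply: lerXn2r; rewrite ?nnegrE.
- by case/andP: (I01 (x - displacement w s) (theta s w)).
- by case/andP: (I01 (y - displacement w s) (theta s w)).
by apply: IH; rewrite lerD2r.
Qed.

Definition profile x w : R := limn (fun n => iterate n x w).

Lemma cvg_iterate x w : iterate n x w @[n --> \oo] --> profile x w.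
Proof.
apply: nondecreasing_is_cvgn; first exact: iterate_nondecreasing.
by exists 1 => _ [n _ <-]; case/andP: ((iterate_admissible n).2 x w).
Qed.

Lemma iterate_le_profile n x w : iterate n x w <= profile x w.
Proof.
apply: (nondecreasing_cvgn_le (iterate_nondecreasing x w)).
by apply/cvg_ex; exists (profile x w); exact: cvg_iterate.
Qed.

Lemma profile_le x w (M : R) : (forall n, iterate n x w <= M) -> profile x w <= M.
Proof.
by move=> H; apply: (cvgr_to_le (@cvg_iterate x w)); exact: nearW.
Qed.

Lemma barrier_le_profile x w : barrier x <= profile x w.
Proof. exact: (iterate_le_profile 0). Qed.

Lemma profile_monotone w : {homo (fun x => profile x w) : x y / x <= y}.
Proof.
move=> x y xy; apply: profile_le => n.
by apply: le_trans (iterate_le_profile n y w); exact: iterate_monotone.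
Qed.

Lemma profile_admissible : admissible profile.
Proof.
split.
  apply: (measurable_fun_cvg (fun n => (iterate_admissible n).1)) => p _.
  exact: cvg_iterate.
move=> x w; rewrite (le_trans (barrier_ge0 x) (barrier_le_profile x w))/=.
by apply: profile_le => n; case/andP: ((iterate_admissible n).2 x w).
Qed.

(** Monotone convergence, since the source is a continuous and nondecreasing
    function of Psi with nonnegative values. *)
Lemma profile_fixed x w : profile x w = step profile x w.
Proof.
apply: EFin_inj.
pose g n (s : measurableTypeR R) := (expR (decay w s) * source (iterate n) x w s)%:E.
pose D : set (measurableTypeR R) := `]-oo, 0]%classic.
have mg (n : nat) : measurable_fun D (g n).
  have := measurable_duhamel (is_derive_decay env w) 0
    (measurable_source_orbit env mu_gt0 x w (iterate_admissible n)).
  rewrite decay0; under eq_fun do rewrite subr0.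
  exact: measurable_EFin_restr.
have g0 (n : nat) s : D s -> (0 <= g n s)%E.
  move=> _; rewrite lee_fin mulr_ge0 ?expR_ge0//.
  by apply: (source_ge0 mu env); exact: iterate_admissible.
have gn s : D s -> {homo g ^~ s : n m / (n <= m)%N >-> (n <= m)%E}.
  move=> _ n m nm; rewrite lee_fin ler_wpM2l ?expR_ge0//.
  apply: (source_le mu env); first exact: iterate_admissible.
  by move=> y v; exact: iterate_nondecreasing.
have mD : measurable D by exact: measurable_itv.
have := cvg_monotone_convergence (mu := leb) mD mg g0 gn.
have -> : (\int[leb]_(s in D) limn (g ^~ s) =
    \int[leb]_(s in D) (expR (decay w s) * source profile x w s)%:E)%E.
  apply: eq_integral => s _; apply/cvg_lim => //.
  apply: cvg_EFin; first exact: nearW.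
  apply: cvgM; first exact: cvg_cst.
  apply: cvgD; first by apply: cvgD; exact: cvg_iterate.
  apply: cvgM; first exact: cvg_cst.
  by apply: cvgM; exact: cvg_iterate.
have fin Psi : admissible Psi -> (\int[leb]_(s in D)
     (expR (decay w s) * source Psi x w s)%:E)%E = (step Psi x w)%:E.
  move=> P; rewrite (stepE env mu_gt0 _ _ P) /duhamel; apply: eq_integral => s _.
  by rewrite decay0 subr0.
rewrite (fin _ profile_admissible) => H.
apply: (@cvg_unique _ (@ereal_hausdorff R) _ _ _ _ _ H).
have -> : (fun n => \int[leb]_(s in D) g n s)%E =
   (fun n => (iterate (n + 1) x w)%:E).
  apply/funext => n; rewrite /g (fin _ (iterate_admissible n)).
  by rewrite addn1.
apply: cvg_EFin; first exact: nearW.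
by have := @cvg_iterate x w; rewrite -(cvg_shiftn 1).
Qed.

End Profile.

(** * Supersolutions at the two edges *)

Section Arithmetic.
Context {R : realType}.

(** Applied with V = exp (- mu z) and W = exp (- mu1 z): the truncation p <= 1
    is used where D W >= V, and elsewhere V ^+ 2 <= W absorbs the square. *)
Lemma quadratic_gap (V W D p : R) : 0 <= W -> 0 <= D -> 0 <= p <= 1 ->
  p <= 1 - V + D * W -> (D * W < V -> V ^+ 2 <= W) ->
  p ^+ 2 <= 1 - 2 * V + 2 * (D * W) + W.
Proof.
move=> W0 D0 /andP[p0 p1] pV VW.
have DW : 0 <= D * W by rewrite mulr_ge0.
have [VD|VD] := leP V (D * W).
  have : p ^+ 2 <= 1 by rewrite expr_le1.
  by lra.
have := VW VD; set q := V - D * W => H.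
have H1 : p ^+ 2 <= (1 - q) ^+ 2.
  by rewrite lerXn2r ?nnegrE// /q; lra.
have H2 : q ^+ 2 <= V ^+ 2.
  by rewrite lerXn2r ?nnegrE// /q; lra.
have : (1 - q) ^+ 2 = 1 - 2 * V + 2 * (D * W) + q ^+ 2 by rewrite /q; ring.
by lra.
Qed.

(** The supersolution inequality for 1 - V + D W after the time derivatives
    have been inserted. Once the bounds on p, q and r and the equation for D
    are used, the difference of the two sides is
    D W (h - (lap mu1 - mu1 / mu lap mu)). *)
Lemma leading_edge_inequality (mu mu1 k h al V W D dD p q r : R) :
  mu != 0 -> k = mu1 / mu - 1 -> lap mu1 - mu1 / mu * lap mu <= h ->
  0 <= D -> 0 <= W -> dD + (k * al - h) * D = al ->
  p <= 1 - expR (- mu) * V + D * (expR (- mu1) * W) ->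
  q <= 1 - expR mu * V + D * (expR mu1 * W) ->
  al * r <= al * (1 - 2 * V + 2 * (D * W) + W) ->
  p + q + al * r <=
  - (mu * (lap mu / mu + mu^-1 * al) * V)
  + (D * (mu1 * (lap mu / mu + mu^-1 * al) * W) + W * dD)
  + (2 + al) * (1 - V + D * W).
Proof.
move=> mu0 -> hl D0 W0 ode Hp Hq Hr.
have N : 0 <= D * W * (h - (lap mu1 - mu1 / mu * lap mu)).
  by rewrite mulr_ge0 ?subr_ge0// mulr_ge0.
apply: (le_trans (lerD (lerD Hp Hq) Hr)); rewrite -subr_ge0.
have -> : dD = al - ((mu1 / mu - 1) * al - h) * D.
  by apply/eqP; rewrite eq_sym subr_eq ode.
move: N; rewrite /lap; congr (0 <= _); field; exact: mu0.
Qed.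

(** Same computation for B E with E = exp (lam z); here the bounds on p, q and r
    leave the difference E (dB + (k al - h) B). *)
Lemma trailing_edge_inequality (mu lam q0 k h al E B dB p q r : R) :
  mu != 0 -> k = 1 - q0 - lam / mu -> h = lam / mu * lap mu + lap lam ->
  0 <= E -> 0 <= dB + (k * al - h) * B ->
  p <= B * (expR lam * E) -> q <= B * (expR (- lam) * E) ->
  al * r <= al * (q0 * (B * E)) ->
  p + q + al * r <=
  (B * (- lam * (lap mu / mu + mu^-1 * al) * E) + E * dB)
  + (2 + al) * (B * E).
Proof.
move=> mu0 -> -> E0 ode Hp Hq Hr.
have N := mulr_ge0 E0 ode.
apply: (le_trans (lerD (lerD Hp Hq) Hr)); rewrite -subr_ge0.
move: N; rewrite /lap; congr (0 <= _); field; exact: mu0.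
Qed.

(** The hypothesis forces 0 < y, and then mu1 <= 2 mu gives the claim; this is
    the reason for the upper bound 2 mu on mu1. *)
Lemma expR_sqr_le (mu mu1 y : R) : mu < mu1 -> mu1 <= 2 * mu ->
  expR (- mu1 * y) < expR (- mu * y) ->
  expR (- mu * y) ^+ 2 <= expR (- mu1 * y).
Proof.
move=> h1 h2; rewrite ltr_expR => y0; rewrite expr2 -expRD ler_expR.
have {}y0 : 0 < y by rewrite -(@pmulr_rgt0 _ (mu1 - mu)) ?subr_gt0//; lra.
by have := ler_wpM2r (ltW y0) h2; lra.
Qed.

Lemma barrier_le_supersolution (mu mu1 D z : R) : 0 < mu -> mu < mu1 -> 1 <= D ->
  barrier mu z <= 1 - expR (- mu * z) + D * expR (- mu1 * z).
Proof.
move=> mu0 mu1l D1; have D0 : 0 <= D by exact: le_trans ler01 D1.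
have DW : 0 <= D * expR (- mu1 * z) by rewrite mulr_ge0// expR_ge0.
rewrite ge_max; apply/andP; split; last by rewrite lerDl.
have [z0|z0] := leP 0 z.
  rewrite addr_ge0// subr_ge0 expR_le1 mulNr oppr_le0.
  by rewrite mulr_ge0// ltW.
have H1 : expR (- mu * z) <= expR (- mu1 * z).
  by rewrite ler_expR !mulNr lerN2 ler_nM2r// ltW.
have H2 : expR (- mu1 * z) <= D * expR (- mu1 * z) by rewrite ler_peMl ?expR_ge0.
by lra.
Qed.

End Arithmetic.

Section Bounds.
Context {R : realType} {d : measure_display} {Omega : measurableType d}.
Context (theta : R -> Omega -> Omega) (a : Omega -> R) (mu : R).
Implicit Types (Psi : R -> Omega -> R) (w : Omega) (x s t z : R).
Hypothesis env : environment theta a.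
Hypothesis mu_gt0 : 0 < mu.

Let a_gt0 := rate_gt0 env.
Let a_cont := rate_continuous env.

Notation step := (step theta a mu).
Notation source := (source theta a mu).
Notation displacement := (displacement theta a mu).
Notation decay := (decay theta a).
Notation barrier := (barrier mu).
Notation profile := (profile theta a mu).

(** A bound that holds for barrier and is preserved by the operator holds for
    all iterates, hence for the limit. The bound may depend on time along the
    orbit of a fixed w. That Psi <= profile may be assumed allows a bound
    already obtained for the profile to be used in the proof of the next one.
    *)
Lemma orbit_induction w (U : R -> R -> R) :
  (forall z t, barrier z <= U z t) ->
  (forall Psi, admissible Psi -> (forall y v, Psi y v <= profile y v) ->
     (forall z t, Psi z (theta t w) <= U z t) ->
     forall z t, step Psi z (theta t w) <= U z t) ->
  forall z t, profile z (theta t w) <= U z t.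
Proof.
move=> U0 US z t; apply: (profile_le env mu_gt0) => n.
elim: n z t => [|n IH] z t; first exact: U0.
apply: US IH z t; first exact: iterate_admissible.
by move=> y v; exact: iterate_le_profile.
Qed.

Lemma step_supersolution Psi w x t (H dH : R -> R) : admissible Psi ->
  (forall s, is_derive s (1 : R) H (dH s)) -> continuous dH ->
  (forall s, 0 <= H s) ->
  (forall s, source Psi x w s <= dH s + (2 + a (theta s w)) * H s) ->
  step Psi (x - displacement w t) (theta t w) <= H t.
Proof.
move=> P dHs cdH H0 FH; rewrite (step_orbit env mu_gt0)// -lee_fin.
rewrite fineK; last exact: (duhamel_source_fin env mu_gt0).
apply: (@duhamel_le _ _ _ (is_derive_decay env w) (@continuous_rate _ _ _ _ _ env w)
   _ H dH) => //.
- exact: (measurable_source_orbit env mu_gt0).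
- by move=> s; exact: (source_ge0 mu env).
Qed.

(** The exponential of rate mu1 grows in time at rate mu1 c, whereas the
    linearised equation prescribes lap mu1 + a; the excess is at least
    k a - h. Its averages over long windows are bounded below by a positive
    number because h < k b, and D is the corresponding corrector. *)
Lemma leading_edge_bound w (mu1 k h b C : R) :
  mu < mu1 <= 2 * mu -> k = mu1 / mu - 1 -> 0 <= h ->
  lap mu1 - mu1 / mu * lap mu <= h -> h < k * b ->
  (forall s t, s <= t -> b * (t - s) - C <= oint (fun r => a (theta r w)) s t) ->
  exists M : R, forall z t,
    profile z (theta t w) <= 1 - expR (- mu * z) + M * expR (- mu1 * z).
Proof.
move=> /andP[mu1l mu1u] kE h0 hl hkb Hb.
have k0 : 0 < k by rewrite kE subr_gt0 ltr_pdivlMr// mul1r.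
have k1 : k <= 1 by rewrite kE; rewrite lerBlDr ler_pdivrMr//; lra.
have [D [dD [M [dDs cdD DM ode]]]] := corrector (@a_cont w)
  (fun t => ltW (a_gt0 (theta t w))) k0 h0 hkb Hb.
have D1 t : 1 <= D t.
  by have /andP[+ _] := DM t; apply: le_trans; rewrite invf_ge1.
have D0 t : 0 <= D t by exact: le_trans ler01 (D1 t).
have cD := is_derive_continuous dDs.
exists M => z t.
have VW y s : D s * expR (- mu1 * y) < expR (- mu * y) ->
    expR (- mu * y) ^+ 2 <= expR (- mu1 * y).
  move=> H; apply: expR_sqr_le => //.
  by apply: le_lt_trans H; rewrite ler_peMl ?expR_ge0.
suff : profile z (theta t w) <= 1 - expR (- mu * z) + D t * expR (- mu1 * z).
  move/le_trans; apply; rewrite lerD2l ler_wpM2r ?expR_ge0//.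
  by case/andP: (DM t).
move: z t; apply: orbit_induction => [z t|Psi P _ IH z t].
  exact: barrier_le_supersolution.
pose x := z + displacement w t.
have -> : z = x - displacement w t by rewrite /x; ring.
pose V s := expR (- mu * (x - displacement w s)).
pose W s := expR (- mu1 * (x - displacement w s)).
pose c s := speed (a (theta s w)) mu.
pose dH s := - (mu * c s * V s) + (D s * (mu1 * c s * W s) + W s * dD s).
have dVs s : is_derive s (1 : R) V (mu * c s * V s) := is_derive_wave env mu_gt0 mu x w s.
have dWs s : is_derive s (1 : R) W (mu1 * c s * W s) := is_derive_wave env mu_gt0 mu1 x w s.
have cV := is_derive_continuous dVs.
have cW := is_derive_continuous dWs.
have cc : continuous c := @continuous_speed _ _ _ _ _ mu env w.
apply: (@step_supersolution Psi w x t (fun s => 1 - V s + D s * W s) dH P).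
- move=> s.
  have := is_deriveD (is_deriveB (is_derive_cst (1 : R) s (1 : R)) (dVs s))
     (is_deriveM (dDs s) (dWs s)).
  by rewrite add0r.
- move=> s; apply: cvgD.
    apply: cvgN; apply: cvgM; last exact: cV.
    by apply: cvgM; [exact: cvg_cst|exact: cc].
  apply: cvgD; apply: cvgM; [exact: cD| |exact: cW|exact: cdD].
  apply: cvgM; last exact: cW.
  by apply: cvgM; [exact: cvg_cst|exact: cc].
- move=> s; apply: le_trans (IH (x - displacement w s) s).
  by case/andP: (P.2 (x - displacement w s) (theta s w)).
move=> s; rewrite /source.
have H1 := IH (x + 1 - displacement w s) s.
have H2 := IH (x - 1 - displacement w s) s.
have H3 := IH (x - displacement w s) s.
have P3 := P.2 (x - displacement w s) (theta s w).
have wave_shift (m e : R) : expR (- m * (x + e - displacement w s)) =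
    expR (- (m * e)) * expR (- m * (x - displacement w s)).
  by rewrite -expRD; congr expR; ring.
move: H1 H2; rewrite !wave_shift !mulr1 !mulrN1 !opprK => H1 H2.
have Q := quadratic_gap (expR_ge0 _) (D0 s) P3 H3 (VW (x - displacement w s) s).
rewrite /dH /c speedE.
apply: (leading_edge_inequality _ kE hl (D0 s) _ (ode s) H1 H2).
- by rewrite gt_eqF.
- exact: expR_ge0.
- by apply: ler_wpM2l Q; rewrite ltW.
Qed.

(** The square is dominated by q0 times the supersolution: for z <= z1 because
    Psi <= q0, and for z > z1 because B is at least 1 / q0 while exp (lam z)
    >= 1. This linear bound with q0 < 1 leaves the net reaction rate (1 - q0)
    a, which beats the drift for small lam. *)
Lemma trailing_edge_bound w (z1 q0 lam k h b C : R) :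
  0 <= z1 -> 0 < q0 < 1 -> (forall z t, z <= z1 -> profile z (theta t w) <= q0) ->
  0 < lam -> k = 1 - q0 - lam / mu -> 0 < k ->
  h = lam / mu * lap mu + lap lam -> h < k * b ->
  (forall s t, s <= t -> b * (t - s) - C <= oint (fun r => a (theta r w)) s t) ->
  exists M : R, forall z t, profile z (theta t w) <= M * expR (lam * z).
Proof.
move=> z10 /andP[q00 q01] pq lam0 kE k0 hE hkb Hb.
have h0 : 0 <= h.
  rewrite hE addr_ge0// ?mulr_ge0 ?invr_ge0// ltW//; apply: lap_gt0; by rewrite gt_eqF.
have [D [dD [M [dDs cdD DM ode]]]] := corrector (@a_cont w)
  (fun t => ltW (a_gt0 (theta t w))) k0 h0 hkb Hb.
have k1 : k <= 1.
  by rewrite kE -addrA gerDl -opprD oppr_le0 addr_ge0 ?divr_ge0// ltW.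
(* The factor makes q0 * B >= 1, since D >= k^-1 >= 1. *)
pose B s := q0^-1 * D s.
pose dB s := q0^-1 * dD s.
have Bq t : 1 <= q0 * B t.
  rewrite /B mulrA divff ?gt_eqF// mul1r.
  by have /andP[+ _] := DM t; apply: le_trans; rewrite invf_ge1.
have q0i : 0 < q0^-1 by rewrite invr_gt0.
have B0 t : 0 <= B t.
  by rewrite -(pmulr_rge0 _ q00); exact: le_trans ler01 (Bq t).
have B1 t : 1 <= B t by apply: (le_trans (Bq t)); rewrite ler_piMl// ltW.
have dBs s : is_derive s (1 : R) B (dB s) := is_deriveZ q0^-1 (dDs s).
have cdB : continuous dB by move=> s; apply: cvgM; [exact: cvg_cst|exact: cdD].
have cB := is_derive_continuous dBs.
exists (q0^-1 * M) => z t.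
suff : profile z (theta t w) <= B t * expR (lam * z).
  move/le_trans; apply; rewrite ler_wpM2r ?expR_ge0//.
  by rewrite ler_pM2l//; case/andP: (DM t).
move: z t; apply: orbit_induction => [z t|Psi P Pp IH z t].
  rewrite ge_max mulr_ge0 ?expR_ge0//=.
  have [z0|z0] := leP 0 z.
    apply: (@le_trans _ _ 1); first by rewrite gerBl expR_ge0.
    rewrite -[leLHS]mulr1 ler_pM// -[leLHS]expR0 ler_expR mulr_ge0//; exact: ltW.
  apply: (@le_trans _ _ 0); last by rewrite mulr_ge0// expR_ge0.
  rewrite subr_le0 -[leLHS]expR0 ler_expR mulNr -mulrN mulr_ge0// ?ltW//.
  by rewrite oppr_gt0.
pose x := z + displacement w t.
have -> : z = x - displacement w t by rewrite /x; ring.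
pose E s := expR (- - lam * (x - displacement w s)).
pose c s := speed (a (theta s w)) mu.
pose dH s := B s * (- lam * c s * E s) + E s * dB s.
have EE s : E s = expR (lam * (x - displacement w s)) by rewrite /E opprK.
have dEs s : is_derive s (1 : R) E (- lam * c s * E s) :=
  is_derive_wave env mu_gt0 (- lam) x w s.
have cE := is_derive_continuous dEs.
have cc : continuous c := @continuous_speed _ _ _ _ _ mu env w.
rewrite -EE.
apply: (@step_supersolution Psi w x t (fun s => B s * E s) dH P).

- move=> s; apply: cvgD; apply: cvgM; [exact: cB| |exact: cE|exact: cdB].
  apply: cvgM; last exact: cE.
  by apply: cvgM; [exact: cvg_cst|exact: cc].
- by move=> s; rewrite mulr_ge0// expR_ge0.
move=> s; rewrite /source.
have H1 := IH (x + 1 - displacement w s) s.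
have H2 := IH (x - 1 - displacement w s) s.
have H3 := IH (x - displacement w s) s.
have Q : Psi (x - displacement w s) (theta s w) ^+ 2 <= q0 * (B s * E s).
  have /andP[P0 P1] := P.2 (x - displacement w s) (theta s w).
  have [zz|zz] := leP (x - displacement w s) z1.
    rewrite expr2 EE; apply: ler_pM => //.
    exact: le_trans (Pp _ _) (pq _ _ zz).
  apply: (@le_trans _ _ 1); first by rewrite expr_le1.
  rewrite mulrA -[leLHS]mulr1 ler_pM// EE -[leLHS]expR0 ler_expR mulr_ge0//.
    exact: ltW.
  exact: le_trans z10 (ltW zz).
have wave_shift (e : R) : expR (lam * (x + e - displacement w s)) =
    expR (lam * e) * E s.
  by rewrite EE -expRD; congr expR; ring.
move: H1 H2; rewrite !wave_shift !mulr1 !mulrN1 => H1 H2.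
rewrite /dH /c speedE.
apply: (trailing_edge_inequality _ kE hE _ _ H1 H2).
- by rewrite gt_eqF.
- exact: expR_ge0.
- rewrite /dB /B mulrCA -mulrDr ode mulr_ge0//; exact: ltW.
- by apply: ler_wpM2l Q; rewrite ltW.
Qed.

End Bounds.

(** * The entire solution *)

Section EntireSolution.
Context {R : realType} {d : measure_display} {Omega : measurableType d}.
Context (theta : R -> Omega -> Omega) (a : Omega -> R) (mu : R).
Implicit Types (w : Omega) (x s t z : R).
Hypothesis env : environment theta a.
Hypothesis mu_gt0 : 0 < mu.

Let a_gt0 := rate_gt0 env.
Let a_cont := rate_continuous env.

Notation source := (source theta a mu).
Notation displacement := (displacement theta a mu).
Notation decay := (decay theta a).
Notation barrier := (barrier mu).
Notation profile := (profile theta a mu).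

Let profile_ad := profile_admissible env mu_gt0.

Let orbit_profile x w t :=
  profile (x - displacement w t) (theta t w).

Lemma profile_duhamel x w t :
  orbit_profile x w t = fine (duhamel (decay w) (source profile x w) t).
Proof. by rewrite /orbit_profile (profile_fixed env mu_gt0) (step_orbit env mu_gt0). Qed.

Lemma profile_duhamelE x w t :
  (orbit_profile x w t)%:E = duhamel (decay w) (source profile x w) t.
Proof. by rewrite profile_duhamel fineK// (duhamel_source_fin env mu_gt0). Qed.

Let source_finite x w t : (duhamel (decay w) (source profile x w) t < +oo)%E.
Proof. by rewrite -profile_duhamelE ltry. Qed.

Let msource x w : measurable_fun setT (source profile x w).
Proof. exact: (measurable_source_orbit env mu_gt0). Qed.

Let source0 x w s : 0 <= source profile x w s.
Proof. exact: (source_ge0 mu env). Qed.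

Lemma orbit_profileE x w :
  orbit_profile x w = fun t => fine (duhamel (decay w) (source profile x w) t).
Proof. by apply/funext => t; rewrite profile_duhamel. Qed.

Lemma continuous_orbit_profile x w : continuous (orbit_profile x w).
Proof.
rewrite orbit_profileE.
exact: (continuous_duhamel (is_derive_decay env w) (msource x w) (source0 x w)
  (source_finite x w)).
Qed.

Lemma is_derive_orbit_profile x w t :
  is_derive t (1 : R) (orbit_profile x w)
    (orbit_profile (x + 1) w t + orbit_profile (x - 1) w t
     + a (theta t w) * orbit_profile x w t ^+ 2
     - (2 + a (theta t w)) * orbit_profile x w t).
Proof.
have cs : continuous (source profile x w).
  move=> s; apply: cvgD.
    by apply: cvgD; exact: continuous_orbit_profile.
  apply: cvgM; first exact: a_cont.
  by apply: cvgM; exact: continuous_orbit_profile.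
have dS := is_derive_duhamel (is_derive_decay env w) (msource x w) (source0 x w)
  (source_finite x w) t cs.
rewrite -(orbit_profileE x w) in dS.
have E := profile_duhamel x w t; rewrite -E in dS.
exact: dS.
Qed.

(** The front recedes to -oo as t -> -oo, so that a fixed site is far ahead of
    it in the remote past, where barrier > 0; positivity then propagates
    forward. *)
Lemma profile_gt0 x w : 0 < profile x w.
Proof.
have L0 : 0 < lap mu by apply: lap_gt0; rewrite gt_eqF.
(* r solves lap mu / mu * r = - (`|x| + 1), so the front is left of x - 1 then. *)
pose r := - ((`|x| + 1) * mu / lap mu).
have r0 : r <= 0.
  rewrite oppr_le0; apply: divr_ge0; last exact: ltW.
  by apply: mulr_ge0; [rewrite addr_ge0|exact: ltW].
have Xr : displacement w r <= - (`|x| + 1).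
  rewrite (displacementE env)// ler_pdivrMr//.
  have := growth_le env w r0; rewrite growth0 => gr.
  have -> : lap mu * r = - (`|x| + 1) * mu by rewrite /r; field; rewrite gt_eqF.
  by rewrite gerDl.
have xr : 0 < x - displacement w r.
  have x1 := ler_norm (- x); rewrite normrN in x1.
  rewrite subr_gt0; apply: (le_lt_trans Xr).
  by rewrite ltrNl ltr_pwDr.
have pr : 0 < orbit_profile x w r.
  apply: lt_le_trans (barrier_le_profile env mu_gt0 _ _).
  apply: lt_le_trans (barrier_ge _ _).
  by rewrite subr_gt0 expR_lt1 mulNr oppr_lt0 mulr_gt0.
have := profile_duhamelE x w 0.
rewrite /orbit_profile displacement0 subr0 (flow0 env) -lte_fin => ->.
apply: (duhamel_gt0 (is_derive_decay env w) (msource x w) (source0 x w) r0).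
by rewrite -profile_duhamelE lte_fin.
Qed.

Lemma front_entire_solution :
  entire_solution theta a
    (fun i t w => 1 - profile (i%:~R - displacement w t) (theta t w)).
Proof.
move=> w i t; have := is_deriveB (is_derive_cst (1 : R) t (1 : R))
  (is_derive_orbit_profile i%:~R w t).
rewrite add0r intrD intrB mulr1z; congr (is_derive _ _ _ _).
rewrite /orbit_profile; ring.
Qed.

End EntireSolution.

(** * Exponents, speeds and linear lower bounds *)

Section Exponents.
Context {R : realType}.
Implicit Types (m x y e : R).

Lemma lap_ge0 m : 0 <= lap m.
Proof.
rewrite /lap; have := expR_ge1Dx m; have := expR_ge1Dx (- m); lra.
Qed.

Lemma lap_convex (l x y : R) : 0 <= l <= 1 ->
  lap ((1 - l) * x + l * y) <= (1 - l) * lap x + l * lap y.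
Proof.
move=> /andP[l0 l1].
have conv (u v : R) :
    expR ((1 - l) * u + l * v) <= (1 - l) * expR u + l * expR v.
  set m := _ + _; have tangent (z : R) : expR m * (1 + (z - m)) <= expR z.
    have -> : expR z = expR m * expR (z - m) by rewrite -expRD addrC subrK.
    by rewrite ler_pM2l ?expR_gt0// expR_ge1Dx.
  have l1' : 0 <= 1 - l by rewrite subr_ge0.
  apply: le_trans (lerD (ler_wpM2l l1' (tangent u)) (ler_wpM2l l0 (tangent v))).
  by rewrite le_eqVlt; apply/orP; left; apply/eqP; rewrite /m; ring.
have c1 := conv x y; have c2 := conv (- x) (- y).
have E : (1 - l) * - x + l * - y = - ((1 - l) * x + l * y) by ring.
by rewrite E in c2; rewrite /lap; lra.
Qed.

Lemma continuous_lap : continuous (@lap R).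
Proof.
move=> m; apply: cvgB; last exact: cvg_cst.
apply: cvgD; first exact: continuous_expR.
by apply: continuous_comp; [exact: oppr_continuous|exact: continuous_expR].
Qed.

Lemma speed_lap (al m : R) : speed al m = (lap m + al) / m.
Proof. by []. Qed.

(** mu1 is the convex combination of mu and nu with weight mu / nu on nu; this
    weight makes mu1 <= 2 mu. By convexity lap mu1 + al is at most the
    combination of mu (speed mu) and nu (speed nu), which is less than mu1
    (speed mu). *)
Lemma slower_exponent (al mu nu : R) : 0 < mu < nu ->
  speed al nu < speed al mu ->
  exists2 mu1, mu < mu1 <= 2 * mu & speed al mu1 < speed al mu.
Proof.
move=> /andP[mu0 mun] sp; have nu0 : 0 < nu by exact: lt_trans mun.
pose l := mu / nu.
have l0 : 0 < l by rewrite divr_gt0.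
have l1 : l < 1 by rewrite ltr_pdivrMr// mul1r.
pose mu1 := (1 - l) * mu + l * nu.
have mu1E : mu1 = mu + l * (nu - mu) by rewrite /mu1; ring.
have lnu : l * nu = mu by rewrite /l; field; rewrite gt_eqF.
exists mu1.
  apply/andP; split; first by rewrite mu1E ltrDl mulr_gt0// subr_gt0.
  rewrite mu1E mulrBr lnu mulr2n mulrDl mul1r lerD2l gerBl mulr_ge0// ltW//.
have mu10 : 0 < mu1 by rewrite mu1E ltr_wpDr// mulr_ge0 ?ltW// subr_gt0.
rewrite speed_lap ltr_pdivrMr//.
have l01 : 0 <= l <= 1 by rewrite !ltW.
apply: (@le_lt_trans _ _ ((1 - l) * (lap mu + al) + l * (lap nu + al))).
  by have := lap_convex mu nu l01; rewrite -/mu1; lra.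
have -> : lap mu + al = speed al mu * mu by rewrite speed_lap mulfVK// gt_eqF.
have -> : lap nu + al = speed al nu * nu by rewrite speed_lap mulfVK// gt_eqF.
have := sp; rewrite -(ltr_pM2r nu0) -(ltr_pM2l l0) /mu1; lra.
Qed.

(** Intermediate values between nu, where the speed is too small, and min nu
    (al / gamma), where it is at least gamma because lap >= 0. *)
Lemma exponent_exists (al nu gamma : R) : 0 < al -> 0 < nu -> speed al nu < gamma ->
  exists2 mu, 0 < mu < nu & speed al mu = gamma.
Proof.
move=> al0 nu0 sp.
have s0 : 0 < speed al nu.
  by rewrite speed_lap divr_gt0// ltr_wpDl// lap_ge0.
have g0 : 0 < gamma by exact: lt_trans sp.
pose m0 := Num.min nu (al / gamma).
have m00 : 0 < m0 by rewrite lt_min nu0 divr_gt0.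
have m0nu : m0 <= nu by rewrite ge_min lexx.
have m0g : gamma <= speed al m0.
  rewrite speed_lap ler_pdivlMr//; apply: (@le_trans _ _ al).
    by rewrite mulrC -ler_pdivlMr// ge_min lexx orbT.
  by rewrite lerDr lap_ge0.
have cs : {within `[m0, nu], continuous (speed al)}.
  apply: continuous_in_subspaceT => x; rewrite inE/= in_itv/= => /andP[m0x _].
  have x0 : x != 0 by rewrite gt_eqF// (lt_le_trans m00).
  apply: cvgM; last exact: cvgV.
  by apply: cvgD; [exact: continuous_lap|exact: cvg_cst].
have [|mu] := @IVT _ (speed al) m0 nu gamma m0nu cs.
  by rewrite ge_min (ltW sp) orbT le_max m0g.
rewrite in_itv/= => /andP[m0mu munu] smu; exists mu => //.
rewrite (lt_le_trans m00 m0mu)/= lt_neqAle munu andbT.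
by apply: contraTneq sp => <-; rewrite smu ltxx.
Qed.

(** At lam = 0 the inequality reads 0 < (1 - q0) al, and both sides are
    continuous in lam. *)
Lemma small_decay_exponent (mu q0 al : R) : 0 < mu -> 0 < q0 < 1 -> 0 < al ->
  exists2 lam, 0 < lam &
    lam / mu * lap mu + lap lam < (1 - q0 - lam / mu) * al.
Proof.
move=> mu0 /andP[q00 q01] al0.
pose G (lam : R) := (1 - q0 - lam / mu) * al - (lam / mu * lap mu + lap lam).
have cG : G x @[x --> (0 : R)] --> G 0.
  have cdiv : x / mu @[x --> (0 : R)] --> (0 : R) / mu.
    by apply: cvgM; [exact: cvg_id|exact: cvg_cst].
  apply: cvgB.
    apply: cvgM; last exact: cvg_cst.
    by apply: cvgB; [exact: cvg_cst|exact: cdiv].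
  apply: cvgD; last exact: continuous_lap.
  by apply: cvgM; [exact: cdiv|exact: cvg_cst].
have G0 : 0 < G 0.
  have -> : G 0 = (1 - q0) * al by rewrite /G /lap oppr0 expR0; ring.
  by rewrite mulr_gt0// subr_gt0.
have [e /= e0 He] := cvgr_gt _ cG _ G0.
exists (e / 2); first by rewrite divr_gt0.
rewrite -subr_gt0; apply: He => /=.
rewrite sub0r normrN gtr0_norm ?divr_gt0//.
by rewrite ltr_pdivrMr// ltr_pMr// ltr1n.
Qed.

Lemma locally_holder_continuous (f : R -> R) : locally_holder f -> continuous f.
Proof.
move=> Hf t; have [al [C [/andP[al0 al1] [[A B] /= [At Bt] AB]]]] := Hf t.
apply/cvgrPdist_lt => e e0.
pose K := `|C| + 1; have K0 : 0 < K by rewrite ltr_wpDl.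
(* K * r `^ al = e *)
pose r := (e / K) `^ al^-1.
have r0 : 0 < r by rewrite powR_gt0// divr_gt0.
near=> s.
have As : A s by near: s; exact: At.
have Btt : B t := nbhs_singleton Bt.
have sr : `|s - t| < r.
  by near: s; exists r => // y; rewrite /= distrC.
rewrite distrC; apply: (le_lt_trans (AB (s, t) (conj As Btt))) => /=.
have sal : `|s - t| `^ al < e / K.
  have -> : e / K = r `^ al.
    rewrite /r -powRrM mulVf ?gt_eqF// powRr1// ltW// divr_gt0//.
  by rewrite gt0_ltr_powR// nnegrE ltW.
apply: (@le_lt_trans _ _ (K * `|s - t| `^ al)).
  rewrite ler_wpM2r ?powR_ge0// /K; have := ler_norm C; lra.
by rewrite mulrC -ltr_pdivlMr.
Unshelve. all: by end_near. Qed.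

(** Windows shorter than r are covered by the constant C = b r, since f >= 0.
    *)
Lemma lower_mean_linear_bound (f : R -> R) (L b : R) :
  (forall t, 0 <= f t) -> lower_mean f = L%:E -> 0 <= b -> b < L ->
  exists C, forall s t, s <= t -> b * (t - s) - C <= oint f s t.
Proof.
move=> f0 fL b0 bL; have Lb : 0 < L - b by rewrite subr_gt0.
have [r r0 Hr] := lower_mean_ge fL Lb.
exists (b * r) => s t st; have [rts|rts] := leP r (t - s).
  have := Hr _ _ rts; rewrite (_ : L - (L - b) = b); last by ring.
  by apply: le_trans; rewrite gerBl mulr_ge0// ltW.
apply: le_trans (oint_ge0 f0 st).
by rewrite subr_le0 ler_wpM2l// ltW.
Qed.

Lemma near_ninfty_expR (M k e : R) : 0 < k -> 0 < e ->
  \forall x \near -oo, M * expR (k * x) < e.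
Proof.
move=> k0 e0; pose K := `|M| + 1; have K0 : 0 < K by rewrite ltr_wpDl.
near=> x; apply: (@le_lt_trans _ _ (K * expR (k * x))).
  rewrite ler_wpM2r ?expR_ge0// /K; have := ler_norm M; lra.
rewrite -ltr_pdivlMl// -[ltRHS]lnK ?posrE ?mulr_gt0 ?invr_gt0// ltr_expR.
rewrite -ltr_pdivlMl//; near: x; by apply: nbhs_ninfty_lt; exact: num_real.
Unshelve. all: by end_near. Qed.

Lemma near_pinfty_expR (M k e : R) : 0 < k -> 0 < e ->
  \forall x \near +oo, M * expR (- k * x) < e.
Proof.
move=> k0 e0; have := near_ninfty_expR M k0 e0.
move=> [N [_ HN]]; exists (- N); split; first exact: num_real.
by move=> x Nx; rewrite mulNr -mulrN; apply: HN; rewrite ltrNl.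
Qed.

End Exponents.

(** * Behaviour of the profile at infinity *)

Lemma half_gap (R : realFieldType) (V X : R) : X <= 2^-1 * V ->
  1 - V + X <= 1 - V / 2.
Proof. by move=> H; lra. Qed.

Lemma ratio_gap (R : realFieldType) (V X p : R) : 0 < V -> p <= 1 - V + X * V ->
  1 - (1 - p) / V <= X.
Proof.
move=> V0 H; have -> : 1 - (1 - p) / V = (V - 1 + p) / V by field; rewrite gt_eqF.
by rewrite ler_pdivrMr//; lra.
Qed.

Section Front.
Context {R : realType} {d : measure_display} {Omega : measurableType d}.
Context (theta : R -> Omega -> Omega) (a : Omega -> R) (mu : R).
Implicit Types (w : Omega) (x s t z : R).
Hypothesis env : environment theta a.
Hypothesis mu_gt0 : 0 < mu.

Let a_gt0 := rate_gt0 env.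
Let a_cont := rate_continuous env.

Notation profile := (profile theta a mu).

Lemma middle_slope (h k L : R) : 0 < k -> 0 <= h -> h < k * L ->
  exists b, [/\ 0 <= b, b < L & h < k * b].
Proof.
move=> k0 h0 hkL; exists ((h / k + L) / 2).
have hk : h / k < L by rewrite ltr_pdivrMr// mulrC.
have hk0 : 0 <= h / k by rewrite divr_ge0// ltW.
have E : h = k * (h / k) by field; rewrite gt_eqF.
have N : k * (h / k) < k * L by rewrite ltr_pM2l.
by split; [|lra|rewrite {1}E]; lra.
Qed.

Lemma leading_edge w (al nu : R) : mu < nu -> speed al nu < speed al mu -> 0 < al ->
  lower_mean (fun t => a (theta t w)) = al%:E ->
  exists mu1 M, mu < mu1 /\ forall z t,
    profile z (theta t w) <= 1 - expR (- mu * z) + M * expR (- mu1 * z).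
Proof.
move=> munu sp al0 low.
have [mu1 mu1b sp1] := slower_exponent (introT andP (conj mu_gt0 munu)) sp.
have /andP[mu1l mu1u] := mu1b.
have mu10 : 0 < mu1 by exact: lt_trans mu1l.
pose k := mu1 / mu - 1.
(* The corrector requires a nonnegative h. *)
pose h := Num.max 0 (lap mu1 - mu1 / mu * lap mu).
have k0 : 0 < k by rewrite subr_gt0 ltr_pdivlMr// mul1r.
have hk : h < k * al.
  rewrite gt_max mulr_gt0//=.
  move: sp1; rewrite !speed_lap ltr_pdivrMr// => sp1; rewrite -subr_gt0.
  have -> : k * al - (lap mu1 - mu1 / mu * lap mu) =
      (lap mu + al) / mu * mu1 - (lap mu1 + al).
    by rewrite /k; field; rewrite gt_eqF.
  by rewrite subr_gt0.
have h0 : 0 <= h by rewrite le_max lexx.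
have [b [b0 bal hb]] := middle_slope k0 h0 hk.
have [C HC] := lower_mean_linear_bound (fun t => ltW (a_gt0 (theta t w))) low b0 bal.
have hl : lap mu1 - mu1 / mu * lap mu <= h by rewrite le_max lexx orbT.
have [M HM] := leading_edge_bound env mu_gt0 mu1b (erefl k) h0 hl hb HC.
by exists mu1, M.
Qed.

(** The second exponential is at most half of the first one for large z. *)
Lemma profile_gap w mu1 M : mu < mu1 ->
  (forall z t, profile z (theta t w) <= 1 - expR (- mu * z) + M * expR (- mu1 * z)) ->
  exists2 z1, 0 <= z1 & forall z t, z1 <= z ->
    profile z (theta t w) <= 1 - expR (- mu * z) / 2.
Proof.
move=> mu1l HM.
have dmu : 0 < mu1 - mu by rewrite subr_gt0.
have h2 : (0 : R) < 2^-1 by rewrite invr_gt0.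
have [N [_ HN]] := near_pinfty_expR M dmu h2.
exists (`|N| + 1); first by rewrite addr_ge0.
move=> z t Nz; have {}Nz : N < z.
  by apply: lt_le_trans Nz; rewrite (le_lt_trans (ler_norm N))// ltrDl.
apply: (le_trans (HM z t)).
have E : expR (- mu1 * z) = expR (- (mu1 - mu) * z) * expR (- mu * z).
  by rewrite -expRD; congr expR; ring.
have := ler_wpM2r (expR_ge0 (- mu * z)) (ltW (HN z Nz)).
by rewrite -mulrA -E; exact: half_gap.
Qed.

Lemma trailing_edge w (al z1 q0 : R) : 0 < al ->
  lower_mean (fun t => a (theta t w)) = al%:E ->
  0 <= z1 -> 0 < q0 < 1 -> (forall z t, z <= z1 -> profile z (theta t w) <= q0) ->
  exists lam M, 0 < lam /\ forall z t, profile z (theta t w) <= M * expR (lam * z).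
Proof.
move=> al0 low z10 q01 pq.
have [lam lam0 hlam] := small_decay_exponent mu_gt0 q01 al0.
pose k := 1 - q0 - lam / mu.
pose h := lam / mu * lap mu + lap lam.
have h0 : 0 <= h.
  by apply: addr_ge0; [apply: mulr_ge0; [exact/ltW/divr_gt0|]|]; exact: lap_ge0.
have k0 : 0 < k by rewrite -(pmulr_lgt0 _ al0) (le_lt_trans h0).
have [b [b0 bal hb]] := middle_slope k0 h0 hlam.
have [C HC] := lower_mean_linear_bound (fun t => ltW (a_gt0 (theta t w))) low b0 bal.
have [M HM] := trailing_edge_bound env mu_gt0 z10 q01 pq lam0 (erefl k) k0
  (erefl h) hb HC.
by exists lam, M.
Qed.

(** The third bound follows from the first for large z and by monotonicity for
    the other z. *)
Lemma front_edges w (al nu : R) : mu < nu -> speed al nu < speed al mu -> 0 < al ->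
  lower_mean (fun t => a (theta t w)) = al%:E ->
  exists mu1 lam M1 M2, [/\ mu < mu1, 0 < lam,
    forall z t,
      profile z (theta t w) <= 1 - expR (- mu * z) + M1 * expR (- mu1 * z),
    forall z t, profile z (theta t w) <= M2 * expR (lam * z) &
    forall z t, profile z (theta t w) < 1].
Proof.
move=> munu sp al0 low.
have [mu1 [M1 [mu1l HM1]]] := leading_edge munu sp al0 low.
have [z1 z10 Hz1] := profile_gap mu1l HM1.
pose q0 := 1 - expR (- mu * z1) / 2.
have e1 : 0 < expR (- mu * z1) / 2 by rewrite divr_gt0// expR_gt0.
have e2 : expR (- mu * z1) / 2 < 1.
  rewrite ltr_pdivrMr// mul1r (@le_lt_trans _ _ 1)// ?ltr1n//.
  by rewrite expR_le1 mulNr oppr_le0 mulr_ge0// ltW.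
have q01 : 0 < q0 < 1 by rewrite subr_gt0 e2 gtrBl e1.
have pq z t : z <= z1 -> profile z (theta t w) <= q0.
  move=> zz; apply: le_trans (Hz1 z1 t (lexx _)); exact: (profile_monotone env mu_gt0).
have [lam [M2 [lam0 HM2]]] := trailing_edge al0 low z10 q01 pq.
exists mu1, lam, M1, M2; split => // z t.
have zm : z <= Num.max z z1 by rewrite le_max lexx.
apply: (le_lt_trans (profile_monotone env mu_gt0 _ zm)).
have z1m : z1 <= Num.max z z1 by rewrite le_max lexx orbT.
by apply: (le_lt_trans (Hz1 _ t z1m)); rewrite gtrBl divr_gt0// expR_gt0.
Qed.

Section Limits.
Context (w : Omega) (al nu : R).
Hypotheses (munu : mu < nu) (sp : speed al nu < speed al mu) (al0 : 0 < al).
Hypothesis low : lower_mean (fun t => a (theta t w)) = al%:E.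

Let Phi x v := 1 - profile x v.

Lemma front_le_wave x v : Phi x v <= expR (- mu * x).
Proof.
have := le_trans (barrier_ge mu x) (barrier_le_profile env mu_gt0 x v).
by rewrite /Phi !lerBlDr addrC.
Qed.

Lemma front_itv x : 0 < Phi x w < 1.
Proof.
have [mu1 [lam [M1 [M2 [_ _ _ _ H]]]]] := front_edges munu sp al0 low.
have := H x 0; rewrite (flow0 env) => Hx.
rewrite /Phi subr_gt0 Hx/= gtrBl; exact: (profile_gt0 env mu_gt0).
Qed.

Lemma front_cvg_ninfty : unif_cvg (fun x t => Phi x (theta t w)) -oo 1.
Proof.
have [mu1 [lam [M1 [M2 [_ lam0 _ H _]]]]] := front_edges munu sp al0 low.
apply: unif_cvg_near => e e0; have := near_ninfty_expR M2 lam0 e0.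
apply: filterS => x Hx t; apply: le_lt_trans Hx; apply: le_trans (H x t).
rewrite /Phi addrAC subrr add0r normrN ger0_norm//.
by have /andP[] := (profile_admissible env mu_gt0).2 x (theta t w).
Qed.

Lemma front_cvg_pinfty : unif_cvg (fun x t => Phi x (theta t w)) +oo 0.
Proof.
apply: unif_cvg_near => e e0; have := near_pinfty_expR 1 mu_gt0 e0.
apply: filterS => x; rewrite mul1r => Hx t; apply: le_lt_trans Hx.
apply: le_trans (front_le_wave x (theta t w)).
rewrite subr0 /Phi ger0_norm// subr_ge0.
by have /andP[] := (profile_admissible env mu_gt0).2 x (theta t w).
Qed.

Lemma front_wave_ratio :
  unif_cvg (fun x t => Phi x (theta t w) / expR (- mu * x)) +oo 1.
Proof.
have [mu1 [lam [M1 [M2 [mu1l _ H _ _]]]]] := front_edges munu sp al0 low.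
have dmu : 0 < mu1 - mu by rewrite subr_gt0.
apply: unif_cvg_near => e e0; have := near_pinfty_expR M1 dmu e0.
apply: filterS => x Hx t; apply: le_lt_trans Hx.
have E : expR (- mu1 * x) = expR (- (mu1 - mu) * x) * expR (- mu * x).
  by rewrite -expRD; congr expR; ring.
have r1 : Phi x (theta t w) / expR (- mu * x) <= 1.
  by rewrite ler_pdivrMr ?expR_gt0// mul1r front_le_wave.
rewrite distrC ger0_norm ?subr_ge0//.
by apply: ratio_gap; [exact: expR_gt0|rewrite -mulrA -E; exact: H].
Qed.

End Limits.

End Front.

(** * Transition fronts *)

Theorem theorem1p1 (R : realType) (d : measure_display)
    (Omega : measurableType d) (P : probability Omega R)
    (theta : R -> Omega -> Omega) (htheta : ergodic_mds P theta)
    (a : Omega -> R) (a_meas : measurable_fun setT a)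
    (a_gt0 : forall w, 0 < a w)
    (a_holder : forall w, locally_holder (fun t => a (theta t w)))
    (a_means : {ae P, forall w,
       (0 < lower_mean (fun t => a (theta t w)) /\
        lower_mean (fun t => a (theta t w))
          <= upper_mean (fun t => a (theta t w)) /\
        upper_mean (fun t => a (theta t w)) < +oo)%E})
    (a_low a_up : R) (a_low_gt0 : 0 < a_low) (a_up_gt0 : 0 < a_up)
    (Omega0 : set Omega) (Omega0_meas : measurable Omega0)
    (Omega0_full : P Omega0 = 1%E)
    (Omega0_inv : forall t, theta t @` Omega0 = Omega0)
    (Omega0_low : forall w, Omega0 w ->
       lower_mean (fun t => a (theta t w)) = a_low%:E)
    (Omega0_up : forall w, Omega0 w ->
       upper_mean (fun t => a (theta t w)) = a_up%:E)
    (mustar : R)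
    (hmustar : unique
       (fun nu => 0 < nu /\ minimal_speed a_low = speed a_low nu) mustar)
    (gamma : R) (hgamma : minimal_speed a_low < gamma) :
  (exists (u : int -> R -> Omega -> R) (Phi c : R -> Omega -> R),
     [/\ random_transition_front P theta a u Phi c,
         monotone_profile P Phi &
         least_mean_speed P c gamma]) /\
  (forall mu : R, 0 < mu < mustar -> speed a_low mu = gamma ->
     let c := fun t w => speed (a (theta t w)) mu in
     exists (u : int -> R -> Omega -> R) (Phi : R -> Omega -> R),
       [/\ random_transition_front P theta a u Phi c,
           monotone_profile P Phi,
           least_mean_speed P c gamma &
           forall w, Omega0 w ->
             [/\ front_form theta u Phi c w,
                 unif_cvg (fun x t => Phi x (theta t w)) -oo 1 &
                 unif_cvg (fun x t => Phi x (theta t w) / expR (- mu * x)) +oo 1]]).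
Proof.
have [theta_meas theta0 thetaD _ _] := htheta.
have env : environment theta a.
  by split => // w; exact: locally_holder_continuous.
have ae_Omega0 (Q : Omega -> Prop) : (forall w, Omega0 w -> Q w) ->
    {ae P, forall w, Q w}.
  move=> HQ; exists (~` Omega0); split; first exact: measurableC.
    by rewrite probability_setC// Omega0_full subee.
  by move=> w /= nQ Ow; apply: nQ; exact: HQ.

have [[mustar_gt0 minE] _] := hmustar.
rewrite minE in hgamma.
have fronts (mu : R) : 0 < mu < mustar -> speed a_low mu = gamma ->
     let c := fun t w => speed (a (theta t w)) mu in
     exists (u : int -> R -> Omega -> R) (Phi : R -> Omega -> R),
       [/\ random_transition_front P theta a u Phi c,
           monotone_profile P Phi,
           least_mean_speed P c gamma &
           forall w, Omega0 w ->
             [/\ front_form theta u Phi c w,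
                 unif_cvg (fun x t => Phi x (theta t w)) -oo 1 &
                 unif_cvg (fun x t => Phi x (theta t w) / expR (- mu * x)) +oo 1]].
  move=> /andP[mu0 mulu] smu c.
  have sp : speed a_low mustar < speed a_low mu by rewrite smu.
  have profile_ad := profile_admissible env mu0.
  have cc w : continuous (c ^~ w) := @continuous_speed _ _ _ _ _ mu env w.
  pose Phi x w := 1 - profile theta a mu x w.
  pose u (i : int) t w := Phi (i%:~R - displacement theta a mu w t) (theta t w).
  exists u, Phi; split.
  - split.
    + exact: (front_entire_solution env mu0).
    + split=> [x|t].
        apply: measurable_funB; first exact: measurable_cst.
        have mx : measurable_fun setT (fun w : Omega => x : measurableTypeR R).
          exact: measurable_cst.
        have mp : measurable_fun setT (fun w : Omega => (x : measurableTypeR R, w)).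
          exact: measurable_fun_pair mx (@measurable_id _ _ _).
        exact: (measurableT_comp profile_ad.1 mp).
      have mt : measurable_fun setT (fun w : Omega => t : measurableTypeR R).
        exact: measurable_cst.
      have mp : measurable_fun setT (fun w : Omega => (t : measurableTypeR R, w)).
        exact: measurable_fun_pair mt (@measurable_id _ _ _).
      have mth : measurable_fun setT (theta t) := measurableT_comp theta_meas mp.
      rewrite /c (_ : (fun w => _) = fun w => lap mu / mu + mu^-1 * a (theta t w)).
        apply: measurable_funD; first exact: measurable_cst.
        apply: measurable_funM; first exact: measurable_cst.
        exact: (measurableT_comp a_meas mth).
      by apply/funext => w; rewrite speedE.
    + apply: ae_Omega0 => w _; split.
      * exact: (continuous_measurable_fun (@cc w)).
      * exact: openT.
      * move=> K _ cK.
        have /integrableP[_] := continuous_compact_integrable cK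
          (continuous_subspaceT (@cc w)).
        by [].
    + by apply: ae_Omega0 => w _ i t.
    + apply: ae_Omega0 => w Ow; have low := Omega0_low _ Ow; split.
      * exact: (front_itv env mu0 mulu sp a_low_gt0 low).
      * exact: (front_cvg_ninfty env mu0 mulu sp a_low_gt0 low).
      * exact: (front_cvg_pinfty env mu0).
  - apply: ae_Omega0 => w _ x y xy.
    by rewrite /Phi lerD2l lerN2; exact: (profile_monotone env mu0).
  - apply: ae_Omega0 => w Ow.
    have mu0' : 0 < mu^-1 by rewrite invr_gt0.
    have ca : continuous (fun t => a (theta t w)) by exact: (rate_continuous env).
    have := lower_mean_affine (lap mu / mu) ca mu0' (Omega0_low _ Ow).
    rewrite -speedE smu => <-; congr lower_mean.
    by apply/funext => t; rewrite /c speedE.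
  - move=> w Ow; have low := Omega0_low _ Ow; split => //.
    + exact: (front_cvg_ninfty env mu0 mulu sp a_low_gt0 low).
    + exact: (front_wave_ratio env mu0 mulu sp a_low_gt0 low).
split; last exact: fronts.
have [mu mub smu] := exponent_exists a_low_gt0 mustar_gt0 hgamma.
have [u [Phi [front mono mean _]]] := fronts mu mub smu.
by exists u, Phi, (fun t w => speed (a (theta t w)) mu).
Qed.
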